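(* Let $\mathcal{H}$ be a complex Hilbert space and $T\in \boldsymbol{B}(\mathcal{H})$. Then the following conditions are equivalent: (i) $T$ is CPD (conditionally positive definite); (ii) there exist $B,C\in \boldsymbol{B}(\mathcal{H})$ and a $\boldsymbol{B}(\mathcal{H})$-valued Borel semispectral measure $F$ on $[0,\infty)$ with compact support such that $B=B^*$, $C\geq 0$, $F(\{1\})=0$ and $$T^{*n}T^n = I + nB + n^2 C + \int_{[0,\infty)} Q_n(x)\, F(\mathrm{d}x),\quad n=0,1,2,\ldots;$$ (iii) there exists a $\boldsymbol{B}(\mathcal{H})$-valued Borel semispectral measure $M$ on $[0,\infty)$ with compact support such that $$T^{*n}(I-2T^*T+T^{*2}T^2)T^n = \int_{[0,\infty)} x^n\, M(\mathrm{d}x),\quad n=0,1,2,\ldots.$$ Moreover, the triplet $(B,C,F)$ in (ii) and the measure $M$ in (iii) are unique, and $$B = T^*T - I - \tfrac12 M(\{1\}),\qquad C=\tfrac12 M(\{1\}),\qquad F(\Delta)=M(\Delta\setminus\{1\})\ \text{ for every Borel } \Delta\subseteq[0,\infty).$$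
   Context: $\boldsymbol{B}(\mathcal{H})$ is the algebra of bounded linear operators on $\mathcal{H}$. A real sequence $\{\gamma_n\}_{n=0}^\infty$ is conditionally positive definite (CPD) if $\sum_{i,j=0}^k \gamma_{i+j}\lambda_i\bar\lambda_j\geq 0$ for all finite complex sequences $\lambda_0,\ldots,\lambda_k$ with $\sum_{i=0}^k\lambda_i=0$. An operator $T\in\boldsymbol{B}(\mathcal{H})$ is CPD if the sequence $\{\|T^nh\|^2\}_{n=0}^\infty$ is CPD for every $h\in\mathcal{H}$. A $\boldsymbol{B}(\mathcal{H})$-valued Borel semispectral measure on $[0,\infty)$ is a map $F$ from the Borel subsets of $[0,\infty)$ to $\boldsymbol{B}(\mathcal{H})$ that is $\sigma$-additive in the weak operator topology and satisfies $F(\Delta)\geq 0$ for all $\Delta$ (no normalization is assumed). The integral $\int \zeta\,\mathrm{d}F$ is the unique bounded operator with $\langle (\int\zeta\,\mathrm{d}F) h,h\rangle=\int \zeta(x)\,\langle F(\mathrm{d}x)h,h\rangle$ for all $h\in\mathcal{H}$. The polynomials $Q_n$ are defined by $Q_0=Q_1=0$ and $Q_n(x)=\sum_{j=0}^{n-2}(n-j-1)x^j$ for $n\geq 2$. *)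

(* Defs.v *)
From HB Require Import structures.
From mathcomp Require Import all_boot all_order all_algebra.
From mathcomp Require Import sesquilinear complex.
From mathcomp Require Import all_classical all_reals all_analysis.

Set Implicit Arguments.
Unset Strict Implicit.
Unset Printing Implicit Defensive.

Import Order.TTheory GRing.Theory Num.Def Num.Theory.
Import numFieldNormedType.Exports.

Local Open Scope classical_set_scope.
Local Open Scope complex_scope.
Local Open Scope ring_scope.

(* The inner product is linear in its first argument and conjugate-linear in
   its second one; norms take their values in R[i]. *)
HB.mixin Record CompleteNormedModule_isHilbert (R : realType) (H : Type)
    of CompleteNormedModule R[i] H := {
  inner : {dot H for (conjC : R[i] -> R[i])} ;
  inner_norm : forall x : H, `|x| ^+ 2 = inner x x
}.

#[short(type="hilbertType")]
HB.structure Definition Hilbert (R : realType) :=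
  {H of CompleteNormedModule R[i] H & CompleteNormedModule_isHilbert R H}.

Notation "''[' u , v ]" := (inner u v)
  (at level 0, format "''[' u ,  v ]") : ring_scope.

Section BoundedOperators.
Variables (R : realType) (H : hilbertType R).

Record bop : Type := Bop {
  bop_fun :> H -> H ;
  bop_linear : linear bop_fun ;
  bop_bounded : exists M : R[i], 0 <= M /\ forall x, `|bop_fun x| <= M * `|x|
}.

HB.instance Definition _ (f : bop) :=
  GRing.isLinear.Build R[i] H H *:%R (bop_fun f) (@bop_linear f).

Lemma bop_ext (f g : bop) : f =1 g -> f = g.
Proof.
case: f g => f lf bf [g lg bg] /= /funext fg; case: _ / fg in lg bg *.
by congr Bop; exact: Prop_irrelevance.
Qed.

HB.instance Definition _ := gen_eqMixin bop.
HB.instance Definition _ := gen_choiceMixin bop.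

Fact bop0_linear : linear (fun _ : H => 0 : H).
Proof. by move=> a x y; rewrite scaler0 addr0. Qed.

Fact bop0_bounded :
  exists M : R[i], 0 <= M /\ forall x : H, `|0 : H| <= M * `|x|.
Proof. by exists 0; split=> // x; rewrite normr0 mul0r. Qed.

Definition bop0 := Bop bop0_linear bop0_bounded.

Fact bop1_linear : linear (fun x : H => x).
Proof. by []. Qed.

Fact bop1_bounded :
  exists M : R[i], 0 <= M /\ forall x : H, `|x| <= M * `|x|.
Proof. by exists 1; split=> // x; rewrite mul1r. Qed.

Definition bop1 := Bop bop1_linear bop1_bounded.

Fact bopN_linear (f : bop) : linear (fun x => - f x).
Proof. by move=> a x y; rewrite linearP opprD scalerN. Qed.

Fact bopN_bounded (f : bop) :
  exists M : R[i], 0 <= M /\ forall x, `|- f x| <= M * `|x|.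
Proof.
by have [M [M0 fM]] := bop_bounded f; exists M; split=> // x; rewrite normrN.
Qed.

Definition bopN f := Bop (@bopN_linear f) (bopN_bounded f).

Fact bopD_linear (f g : bop) : linear (fun x => f x + g x).
Proof. by move=> a x y; rewrite !linearP scalerDr addrACA. Qed.

Fact bopD_bounded (f g : bop) :
  exists M : R[i], 0 <= M /\ forall x, `|f x + g x| <= M * `|x|.
Proof.
have [M [M0 fM]] := bop_bounded f; have [N [N0 gN]] := bop_bounded g.
exists (M + N); split=> [|x]; first exact: addr_ge0.
by rewrite mulrDl (le_trans (ler_normD _ _))// lerD.
Qed.

Definition bopD f g := Bop (@bopD_linear f g) (bopD_bounded f g).

Fact bopM_linear (f g : bop) : linear (fun x => f (g x)).
Proof. by move=> a x y; rewrite !linearP. Qed.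

Fact bopM_bounded (f g : bop) :
  exists M : R[i], 0 <= M /\ forall x, `|f (g x)| <= M * `|x|.
Proof.
have [M [M0 fM]] := bop_bounded f; have [N [N0 gN]] := bop_bounded g.
exists (M * N); split=> [|x]; first exact: mulr_ge0.
by rewrite (le_trans (fM _))// -mulrA ler_wpM2l.
Qed.

Definition bopM f g := Bop (@bopM_linear f g) (bopM_bounded f g).

Fact bopZ_linear (a : R[i]) (f : bop) : linear (fun x => a *: f x).
Proof. by move=> b x y; rewrite linearP scalerDr !scalerA mulrC. Qed.

Fact bopZ_bounded (a : R[i]) (f : bop) :
  exists M : R[i], 0 <= M /\ forall x, `|a *: f x| <= M * `|x|.
Proof.
have [M [M0 fM]] := bop_bounded f; exists (`|a| * M); split=> [|x].
  exact: mulr_ge0.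
by rewrite normrZ -mulrA ler_wpM2l.
Qed.

Definition bopZ a f := Bop (@bopZ_linear a f) (bopZ_bounded a f).

Fact bopDA : associative bopD.
Proof. by move=> f g h; apply: bop_ext => x /=; rewrite addrA. Qed.

Fact bopDC : commutative bopD.
Proof. by move=> f g; apply: bop_ext => x /=; rewrite addrC. Qed.

Fact bop0D : left_id bop0 bopD.
Proof. by move=> f; apply: bop_ext => x /=; rewrite add0r. Qed.

Fact bopND : left_inverse bop0 bopN bopD.
Proof. by move=> f; apply: bop_ext => x /=; rewrite addNr. Qed.

HB.instance Definition _ := GRing.isZmodule.Build bop bopDA bopDC bop0D bopND.

Fact bopMA : associative bopM.
Proof. by move=> f g h; apply: bop_ext. Qed.

Fact bop1M : left_id bop1 bopM.
Proof. by move=> f; apply: bop_ext. Qed.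

Fact bopM1 : right_id bop1 bopM.
Proof. by move=> f; apply: bop_ext. Qed.

Fact bopMDl : left_distributive bopM +%R.
Proof. by move=> f g h; apply: bop_ext. Qed.

Fact bopMDr : right_distributive bopM +%R.
Proof. by move=> f g h; apply: bop_ext => x /=; rewrite linearD. Qed.

(* The product of the ring [bop H] is composition, its unit the identity. *)
HB.instance Definition _ :=
  GRing.Zmodule_isPzRing.Build bop bopMA bop1M bopM1 bopMDl bopMDr.

Fact bopZA (a b : R[i]) (f : bop) : bopZ a (bopZ b f) = bopZ (a * b) f.
Proof. by apply: bop_ext => x /=; rewrite scalerA. Qed.

Fact bop1Z : left_id 1 bopZ.
Proof. by move=> f; apply: bop_ext => x /=; rewrite scale1r. Qed.

Fact bopZDr : right_distributive bopZ +%R.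
Proof. by move=> a f g; apply: bop_ext => x /=; rewrite scalerDr. Qed.

Fact bopZDl (f : bop) : {morph bopZ^~ f : a b / a + b}.
Proof. by move=> a b; apply: bop_ext => x /=; rewrite scalerDl. Qed.

HB.instance Definition _ :=
  GRing.Zmodule_isLmodule.Build R[i] bop bopZA bop1Z bopZDr bopZDl.

(* The adjoint exists and is unique by the Riesz representation theorem, so the
   default value 0 is never used. *)
Definition adj (T : bop) : bop :=
  xget 0 [set S : bop | forall x y, '[T x, y] = '[x, S y]].

(* The order of R[i] is such that [0 <= z] entails that [z] is real. *)
Definition bop_ge0 (A : bop) : Prop := forall h, 0 <= '[A h, h].

End BoundedOperators.

Section ConditionallyPositiveDefinite.
Variable R : realType.

Definition cpd_seq (gamma : nat -> R) : Prop :=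
  forall (k : nat) (lambda : 'I_k.+1 -> R[i]),
    \sum_i lambda i = 0 ->
    0 <= \sum_(i < k.+1) \sum_(j < k.+1)
           (gamma (i + j)%N)%:C * lambda i * conjC (lambda j).

Definition cpd (H : hilbertType R) (T : bop H) : Prop :=
  forall h : H, cpd_seq (fun n => complex.Re `|(T ^+ n) h| ^+ 2).

End ConditionallyPositiveDefinite.

Section Semispectral.
Variables (R : realType) (H : hilbertType R).

Definition halfline : set R := `[0, +oo[.

Definition borel_halfline (D : set R) : Prop :=
  measurable D /\ D `<=` halfline.

(* Borel semispectral measures on [0, +oo[; the values on sets that are not
   Borel subsets of [0, +oo[ are irrelevant. *)
Record semispectral : Type := Semispectral {
  smeas :> set R -> bop H ;
  smeas_ge0 : forall D, borel_halfline D -> bop_ge0 (smeas D) ;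
  smeas_sigma_additive : forall D : nat -> set R,
    (forall k, borel_halfline (D k)) -> trivIset setT D ->
    forall g h : H,
      (fun n => \sum_(0 <= k < n) '[smeas (D k) g, h] : R[i]^o) @ \oo -->
      ('[smeas (\bigcup_k D k) g, h] : R[i]^o)
}.

Definition eq_semispectral (F G : semispectral) : Prop :=
  forall D, borel_halfline D -> F D = G D.

Definition closed_support (F : semispectral) : set R :=
  \bigcap_(K in [set K | [/\ closed K, K `<=` halfline
                           & F (halfline `\` K) = 0]]) K.

Definition compactly_supported (F : semispectral) : Prop :=
  compact (closed_support F).

(* [qmeasure F h D] is <F(D)h, h>; the modulus only ensures nonnegativity
   on non-measurable sets, as required of measures. *)
Definition qmeasure (F : semispectral) (h : H) (D : set R) : \bar R :=
  (complex.Re `|'[F (D `&` halfline) h, h]|)%:E.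

Lemma borel_halflineI (D : set R) :
  measurable D -> borel_halfline (D `&` halfline).
Proof.
by move=> mD; split=> [|x []//]; apply: measurableI => //; exact: measurable_itv.
Qed.

Lemma qmeasureE (F : semispectral) h D : measurable D ->
  qmeasure F h D = (complex.Re '[F (D `&` halfline) h, h])%:E.
Proof.
move=> mD; rewrite /qmeasure ger0_norm//.
by apply: smeas_ge0; exact: borel_halflineI.
Qed.

Lemma Re_cvg (u : nat -> R[i]^o) (l : R[i]^o) :
  u @ \oo --> l -> (fun n => complex.Re (u n)) @ \oo --> complex.Re l.
Proof.
move=> ul; apply/cvgrPdist_lt => e e0.
have e0' : 0 < e%:C by rewrite ltcR.
move/cvgrPdist_lt : ul => /(_ _ e0'); apply: filterS => n.
rewrite -ltcR; apply: le_lt_trans.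
rewrite -raddfB.
exact: normc_ge_Re.
Qed.

Lemma smeas0 (F : semispectral) (g h : H) : '[F set0 g, h] = 0.
Proof.
have b0 : borel_halfline set0 by split.
have := @smeas_sigma_additive F (fun=> set0) (fun=> b0)
  (@trivIset_set0 _ _ setT) g h.
rewrite bigcup0// => uc.
have us := uc; rewrite -cvg_shiftS in us.
have d0 := cvgB us uc; rewrite subrr in d0.
have da : (fun n => \sum_(0 <= k < n.+1) '[F set0 g, h]
                    - \sum_(0 <= k < n) '[F set0 g, h] : R[i]^o) @ \oo -->
          ('[F set0 g, h] : R[i]^o).
  apply: cvg_near_cst; near=> n.
  by rewrite big_nat_recr//= addrAC subrr add0r.
exact: (cvg_unique (@norm_hausdorff _ R[i]^o) da (d0 _)).
Unshelve. all: by end_near. Qed.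

Lemma qmeasure0 (F : semispectral) h : qmeasure F h set0 = 0%E.
Proof. by rewrite /qmeasure set0I smeas0 normr0. Qed.

Lemma qmeasure_ge0 (F : semispectral) h D : (0 <= qmeasure F h D)%E.
Proof.
rewrite lee_fin; have : 0 <= `|'[F (D `&` halfline) h, h]| by [].
by rewrite lecE => /andP[].
Qed.

Lemma qmeasure_sigma_additive (F : semispectral) h :
  semi_sigma_additive (qmeasure F h).
Proof.
move=> D mD tD mU; rewrite qmeasureE// setI_bigcupl.
have bD k : borel_halfline (D k `&` halfline) by exact: borel_halflineI.
have tDI : trivIset setT (fun k => D k `&` halfline).
  exact: trivIset_setIr.
have /Re_cvg c := @smeas_sigma_additive F _ bD tDI h h.
rewrite (_ : (fun n => _) = EFin \o
  (fun n => complex.Re (\sum_(0 <= k < n) '[F (D k `&` halfline) h, h]))).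
  by apply: cvg_EFin => /=; [exact: nearW | exact: c].
apply/funext => n /=; rewrite raddf_sum -sumEFin.
by apply: eq_bigr => k _; rewrite qmeasureE.
Qed.

HB.instance Definition _ (F : semispectral) (h : H) :=
  isMeasure.Build _ R R (qmeasure F h)
    (qmeasure0 F h) (qmeasure_ge0 F h) (@qmeasure_sigma_additive F h).

Definition is_sintegral (F : semispectral) (zeta : R -> R) (A : bop H) : Prop :=
  forall h : H,
    (qmeasure F h).-integrable halfline (EFin \o zeta) /\
    '[A h, h] = (\int[qmeasure F h]_(x in halfline) zeta x)%:C.

(* At most one operator satisfies [is_sintegral F zeta]; there is one as soon
   as [zeta] is a polynomial and [F] has compact support. *)
Definition sintegral (F : semispectral) (zeta : R -> R) : bop H :=
  xget 0 [set A : bop H | is_sintegral F zeta A].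

End Semispectral.

(* The sum is empty when n <= 1. *)
Definition Qpoly (R : realType) (n : nat) : {poly R} :=
  \sum_(0 <= j < n.-1) (n - j - 1)%:R *: 'X^j.

Section Representations.
Variables (R : realType) (H : hilbertType R) (T : bop H).

Definition cpd_triplet (B C : bop H) (F : semispectral H) : Prop :=
  [/\ adj B = B, bop_ge0 C, compactly_supported F, F [set 1] = 0 &
      forall n : nat,
        adj T ^+ n * T ^+ n =
        1 + B *+ n + C *+ (n ^ 2) + sintegral F (fun x => (Qpoly R n).[x])].

Definition cpd_measure (M : semispectral H) : Prop :=
  compactly_supported M /\
  forall n : nat,
    adj T ^+ n * (1 - (adj T * T) *+ 2 + adj T ^+ 2 * T ^+ 2) * T ^+ n =
    sintegral M (fun x => x ^+ n).

End Representations.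

(* Main.v *)
(* Let gamma_n(h) = |T^n h|^2. A polynomial whose coefficients sum to 0 is a multiple of
   X - 1, so T is CPD if and only if for every h the second difference
   s_n(h) = gamma_n - 2 gamma_{n+1} + gamma_{n+2} = <T*^n (I - 2 T*T + T*^2 T^2) T^n h, h>
   is positive definite. As s_{n+1}(h) = s_n(Th), the shifted sequence is then positive
   definite as well, and |s_n(h)| <= C rho^n; log-convexity bounds multiplication by X by
   rho, so the functional X^n |-> s_n(h) is nonnegative on polynomials that are nonnegative
   on [0, rho] and is given by a unique measure mu_h. Uniqueness and approximation of
   half-lines by polynomials make mu_h(D) a bounded quadratic form in h, which is M(D).
   Summing second differences twice turns (iii) into (ii) with the atom of M at 1
   contributing the quadratic term, since Q_n(1) = n (n - 1) / 2; conversely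
   M = F + 2 C delta_1. *)
Require Import Defs.
From HB Require Import structures.
From mathcomp Require Import all_boot all_order all_algebra.
From mathcomp Require Import sesquilinear complex.
From mathcomp Require Import all_classical all_reals all_analysis.
From mathcomp Require Import measurable_realfun ring lra zify.

Import Order.TTheory GRing.Theory Num.Def Num.Theory.
Import numFieldNormedType.Exports.

Local Open Scope classical_set_scope.
Local Open Scope complex_scope.
Local Open Scope ring_scope.

Set Implicit Arguments.
Unset Strict Implicit.
Unset Printing Implicit Defensive.

(** Nonnegativity on [[0, rho]] has to be reduced to the weights 1, X and rho - X times squares; the
    product X (rho - X), which is not of this kind, is rewritten by rho X (rho - X) = X^2 (rho - X)
    + (rho - X)^2 X. The measure representing a positive functional L is the Lebesgue-Stieltjes
    measure of G y, the infimum of L p over the polynomials p that majorize the indicator of ]-oo,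
    y] on [[0, rho]]. To see that it has the right moments, L and the integral are compared only
    through what they do to polynomials close to such indicators, up to the position of jumps. The
    same step polynomials determine a measure by its moments, and they do not depend on the measure,
    so one sequence serves all h at once. Operators are recovered from scalar data by one device:
    pointwise limits of uniformly bounded positive quadratic forms are forms of operators, by
    polarization, Cauchy-Schwarz and the Riesz theorem. Uniqueness of (B, C, F) is deduced from that
    of M: every triplet yields a measure as in (iii), from which the triplet can be read off. *)

Lemma expr_lt_ex (R : realType) (z e : R) : 0 <= z < 1 -> 0 < e ->
  exists n, z ^+ n < e.
Proof.
move=> /andP[z0 z1] e0; have z1' : `|z| < 1 by rewrite ger0_norm.
have /cvgrPdist_lt/(_ _ e0)[n _ /(_ n (leqnn n))] := cvg_expr z1'.
by rewrite sub0r normrN ger0_norm ?exprn_ge0// => ?; exists n.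
Qed.

(** Evaluate at the minimizer [- b / c]. For [c = 0] and [b != 0] the expression is affine in [t]
    and equals -1 at [- (a + 1) / (2 * b)]. *)
Lemma discr_le (R : realType) (a b c : R) : 0 <= c ->
  (forall t, 0 <= a + 2 * t * b + t ^+ 2 * c) -> b ^+ 2 <= a * c.
Proof.
move=> c0 h; have [c_eq0|c_neq0] := eqVneq c 0.
  have [->|b0] := eqVneq b 0; first by rewrite c_eq0 expr0n mulr0.
  have := h (- (a + 1) / (2 * b)); rewrite c_eq0.
  rewrite (_ : _ + _ = -1) ?ler0N1//.
  by field.
have {}c0 : 0 < c by rewrite lt_def c_neq0.
have := h (- b / c); rewrite (_ : _ + _ = (a * c - b ^+ 2) / c); last by field.
by rewrite pmulr_lge0 ?invr_gt0// subr_ge0.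
Qed.

(** * Linear functionals on real polynomials *)

Section MomentFunctional.
Context {R : realType}.
Implicit Types (s : nat -> R) (p q : {poly R}).

(** The Riesz functional of the sequence [s], linear with ['X^n |-> s n]. *)
Definition mom s p : R := \sum_(i < size p) p`_i * s i.

Lemma mom_widen s p n : (size p <= n)%N -> mom s p = \sum_(i < n) p`_i * s i.
Proof.
move=> pn; rewrite /mom (big_ord_widen n (fun i => p`_i * s i))// big_mkcond/=.
apply: eq_bigr => i _; case: ltnP => // /(nth_default 0) ->.
by rewrite mul0r.
Qed.

Fact mom_is_scalar s : scalar (mom s).
Proof.
move=> a p q; set n := maxn (size p) (size q).
rewrite (@mom_widen _ _ n); last first.
  by rewrite (leq_trans (size_polyD _ _))// geq_max leq_max
    (leq_trans (size_scale_leq _ _)) ?leq_maxr// leq_maxl.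
rewrite (@mom_widen _ _ n) ?leq_maxl// (@mom_widen _ q n) ?leq_maxr//.
rewrite mulr_sumr -big_split/=; apply: eq_bigr => i _.
by rewrite coefD coefZ mulrDl mulrA.
Qed.

HB.instance Definition _ s :=
  GRing.isLinear.Build R {poly R} R *%R (mom s) (mom_is_scalar s).

Lemma mom_Xn s n : mom s 'X^n = s n.
Proof.
rewrite /mom size_polyXn big_ord_recr/= coefXn eqxx mul1r big1 ?add0r// => i _.
by rewrite coefXn ltn_eqF// mul0r.
Qed.

Lemma momMXn s p k : mom s (p * 'X^k) = mom (fun n => s (n + k)%N) p.
Proof.
rewrite -{1}[p]coefK poly_def mulr_suml linear_sum/=; apply: eq_bigr => i _.
by rewrite -scalerAl -exprD linearZ/= mom_Xn.
Qed.

Lemma eq_mom s s' p : s =1 s' -> mom s p = mom s' p.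
Proof. by move=> e; apply: eq_bigr => i _; rewrite e. Qed.

Lemma mom_unique (L : {poly R} -> R) s : scalar L ->
  (forall n, L 'X^n = s n) -> forall p, L p = mom s p.
Proof.
move=> Ll LX p; pose L' : {scalar {poly R}} :=
  HB.pack L (GRing.isLinear.Build R {poly R} R *%R L Ll).
rewrite -[L p]/(L' p) -{1}[p]coefK poly_def (linear_sum L'); apply: eq_bigr => i _.
by rewrite (scalarZ L') /= LX.
Qed.

(** * Log-convex sequences *)

Section LogConvex.
Variable u : nat -> R.
Hypothesis u0 : forall k, 0 <= u k.
Hypothesis ulc : forall k, u k.+1 ^+ 2 <= u k * u k.+2.

(** Log-convexity makes the ratios of consecutive terms nondecreasing. The comparison with the first
    ratio is cross-multiplied, and positivity is carried through the induction so that [u k] can be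
    cancelled. *)
Lemma logconvex_ratio : 0 < u 0%N -> forall k, 0 < u 1%N ->
  0 < u k /\ u 1%N * u k <= u 0%N * u k.+1.
Proof.
move=> u00 k u1; elim: k => [|k [uk IH]]; first by rewrite mulrC.
have uk1 : 0 < u k.+1.
  by rewrite -(pmulr_rgt0 _ u00) (lt_le_trans _ IH)// mulr_gt0.
split=> //; rewrite -(ler_pM2r uk) -mulrA [u k.+1 * _]mulrC mulrA.
rewrite (le_trans (ler_wpM2r (u0 _) IH))// -mulrA -expr2 -mulrA ler_pM2l//.
by rewrite [_ * u k]mulrC.
Qed.

(* The ratios u (k + 1) / u k are nondecreasing, so a first ratio above rho would
   contradict the geometric bound. *)
Lemma logconvex_growth (C rho : R) : 0 < rho ->
  (forall k, u k <= C * rho ^+ k) -> u 1%N <= rho * u 0%N.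
Proof.
move=> rho0 ub; have [u00|u00] := eqVneq (u 0%N) 0.
  have := ulc 0%N; rewrite u00 mul0r => h.
  have /eqP : u 1%N ^+ 2 = 0 by apply/eqP; rewrite eq_le h sqr_ge0.
  by rewrite sqrf_eq0 => /eqP ->; rewrite mulr0.
have {}u00 : 0 < u 0%N by rewrite lt_def u00 u0.
rewrite leNgt; apply/negP => lt1.
have u1 : 0 < u 1%N by rewrite (lt_trans _ lt1)// mulr_gt0.
have C0 : 0 < C by have := ub 0%N; rewrite expr0 mulr1; exact: lt_le_trans.
(* [r * rho] is the first ratio, so [u k] is at least [u 0 * (r * rho) ^+ k], which outgrows
   [C * rho ^+ k] as [r > 1]. *)
pose r := u 1%N / (rho * u 0%N).
have r1 : 1 < r by rewrite /r ltr_pdivlMr ?mul1r// mulr_gt0.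
have uk k : u 0%N * (r * rho) ^+ k <= u k.
  elim: k => [|k IH]; first by rewrite expr0 mulr1.
  have [uk0 h] := logconvex_ratio u00 k u1.
  rewrite exprS mulrCA (le_trans (ler_wpM2l _ IH))//.
    by rewrite mulr_ge0 ?ltW// (lt_trans _ r1).
  rewrite -(ler_pM2l u00) (le_trans _ h)// /r.
  rewrite le_eqVlt; apply/orP; left; apply/eqP; field.
  by rewrite !gt_eqF.
have r0 : 0 < r by rewrite (lt_trans _ r1).
have /expr_lt_ex/(_ (divr_gt0 u00 C0))[k] : 0 <= r^-1 < 1.
  by rewrite invr_ge0 ltW//= invf_lt1.
rewrite exprVn => hk; have {}hk : C / u 0%N < r ^+ k.
  have rk0 := exprn_gt0 k r0; move: hk.
  rewrite -(ltr_pM2l rk0) divff ?gt_eqF// mulrA ltr_pdivlMr// mul1r.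
  by rewrite ltr_pdivrMr.
have := le_trans (uk k) (ub k); rewrite exprMn mulrA.
rewrite ler_pM2r ?exprn_gt0// leNgt => /negP; apply.
by rewrite mulrC -ltr_pdivrMr.
Qed.
End LogConvex.

Section Positivity.
Variables (s : nat -> R) (C rho : R).
Hypothesis rho0 : 0 < rho.
Hypothesis pos : forall q, 0 <= mom s (q ^+ 2).
Hypothesis posX : forall q, 0 <= mom s (q ^+ 2 * 'X).
Hypothesis growth : forall n, `|s n| <= C * rho ^+ n.

Lemma mom_growth q : exists D, forall k, mom s (q * 'X^k) <= D * rho ^+ k.
Proof.
exists (\sum_(i < size q) `|q`_i| * C * rho ^+ i) => k.
rewrite momMXn /mom mulr_suml ler_sum// => i _.
rewrite (le_trans (ler_norm _))// normrM -!mulrA ler_wpM2l//.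
by rewrite (le_trans (growth _))// exprD.
Qed.

(** According to the parity of [k], ['X^k] is a square or ['X] times a square. *)
Lemma mom_pos_even q k : 0 <= mom s (q ^+ 2 * 'X^k).
Proof.
rewrite -(odd_double_half k) -mul2n exprD mulnC exprM mulrCA.
case: (odd k); rewrite ?expr0 ?expr1 ?mul1r -exprMn//.
by rewrite mulrC.
Qed.

(** Cauchy-Schwarz, as the discriminant in [t] of the functional at
    [q ^+ 2 * (t%:P + 'X) ^+ 2 * 'X^k]. *)
Lemma mom_logconvex q k : mom s (q ^+ 2 * 'X^(k.+1)) ^+ 2 <=
  mom s (q ^+ 2 * 'X^k) * mom s (q ^+ 2 * 'X^(k.+2)).
Proof.
set a := mom s (_ * 'X^k); set b := mom s (_ * 'X^(k.+1)).
set c := mom s (_ * 'X^(k.+2)).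
rewrite mulrC; apply: discr_le => [|t]; first exact: mom_pos_even.
have := mom_pos_even (q * (t%:P + 'X)) k.
rewrite (_ : _ * _ = q ^+ 2 * 'X^(k.+2) + (2 * t) *: (q ^+ 2 * 'X^(k.+1)) +
  (t ^+ 2) *: (q ^+ 2 * 'X^k)); first by rewrite !linearD/= !linearZ.
by rewrite -!mul_polyC !polyCM !exprS; ring.
Qed.

Lemma mom_pos_sub q : 0 <= mom s (q ^+ 2 * (rho%:P - 'X)).
Proof.
have [D hD] := mom_growth (q ^+ 2).
have := @logconvex_growth (fun k => mom s (q ^+ 2 * 'X^k)) (mom_pos_even q)
  (mom_logconvex q) _ _ rho0 hD.
rewrite expr0 expr1 mulr1 -subr_ge0 -linearZ/= -linearB/=.
by rewrite mulrBr -mul_polyC [_ * rho%:P]mulrC.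
Qed.

End Positivity.

End MomentFunctional.

(** * Operators and quadratic forms on a Hilbert space *)

Section Hilbert.
Context {R : realType} {H : hilbertType R}.
Implicit Types (x y g h : H) (A B : bop H).

Lemma innerDl x y g : '[x + y, g] = '[x, g] + '[y, g].
Proof. exact: linearDl. Qed.
Lemma innerDr x y g : '[g, x + y] = '[g, x] + '[g, y].
Proof. exact: linearDr. Qed.
Lemma innerZl a x g : '[a *: x, g] = a * '[x, g].
Proof. exact: linearZl_LR. Qed.
Lemma innerZr a x g : '[g, a *: x] = conjC a * '[g, x].
Proof. exact: linearZr_LR. Qed.
Lemma innerNl x g : '[- x, g] = - '[x, g].
Proof. exact: linearNl. Qed.
Lemma innerNr x g : '[g, - x] = - '[g, x].
Proof. exact: linearNr. Qed.
Lemma innerC x y : '[x, y] = conjC '[y, x].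
Proof. by rewrite hermC expr0 mul1r. Qed.

Definition nrm x : R := complex.Re `|x|.

Lemma nrmE x : `|x| = (nrm x)%:C.
Proof. by rewrite /nrm RRe_real// ger0_real. Qed.

Lemma nrm_ge0 x : 0 <= nrm x.
Proof. by rewrite -lecR -nrmE normr_ge0. Qed.

Lemma inner_nrm x : '[x, x] = (nrm x ^+ 2)%:C.
Proof. by rewrite -inner_norm nrmE rmorphXn. Qed.

Lemma conjcE (z : R[i]) : conjC z = conjc z.
Proof. by []. Qed.

Lemma Re_conjc (z : R[i]) : complex.Re (conjC z) = complex.Re z.
Proof. by rewrite conjcE; case: z. Qed.

Lemma conjC_realc (a : R) : conjC a%:C = a%:C :> R[i].
Proof. by rewrite conj_Creal// complex_real. Qed.

Lemma ReD (z w : R[i]) : complex.Re (z + w) = complex.Re z + complex.Re w.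
Proof. by case: z w => ? ? []. Qed.
Lemma ReN (z : R[i]) : complex.Re (- z) = - complex.Re z.
Proof. by case: z. Qed.
Lemma ReZ (a : R) (z : R[i]) : complex.Re (a%:C * z) = a * complex.Re z.
Proof. by case: z => ? ? /=; rewrite mul0r subr0. Qed.

Definition qf A h : R := complex.Re '[A h, h].

Lemma bop_ge0E A : bop_ge0 A -> forall h, '[A h, h] = (qf A h)%:C.
Proof. by move=> A0 h; rewrite /qf RRe_real// ger0_real// A0. Qed.

Lemma bopfD A x y : A (x + y) = A x + A y. Proof. exact: linearD. Qed.
Lemma bopfN A x : A (- x) = - A x. Proof. exact: linearN. Qed.
Lemma bopfZ A a x : A (a *: x) = a *: A x. Proof. exact: linearZ. Qed.

Lemma polarization A g h : 4 * '[A g, h] =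
  '[A (g + h), g + h] - '[A (g - h), g - h] +
  'i%R * ('[A (g + 'i%R *: h), g + 'i%R *: h] -
          '[A (g - 'i%R *: h), g - 'i%R *: h]).
Proof.
rewrite !(bopfD, bopfN, bopfZ).
rewrite !(innerDl, innerDr, innerNl, innerNr, innerZl, innerZr) conjCi.
have i2 : 'i%R * 'i%R = -1 :> R[i] by rewrite -expr2 sqrCi.
move: '[A g, h] '[A h, g] '[A g, g] '[A h, h] => a b c d.
set i := 'i%R in i2 *.
apply/eqP; rewrite -subr_eq0; apply/eqP.
(* [ring] treats [i] as an indeterminate, so the two sides agree up to a multiple of [1 + i * i]. *)
transitivity (2 * (a - b) * (1 + i * i)); first by ring.
by rewrite i2 subrr mulr0.
Qed.

Lemma bop_eqP A B : (forall g h, '[A g, h] = '[B g, h]) -> A = B.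
Proof.
move=> AB; apply: bop_ext => g; apply/eqP; rewrite -subr_eq0; apply/eqP.
have : '[A g - B g, A g - B g] = 0 by rewrite innerDl innerNl AB subrr.
by move/eqP; rewrite dnorm_eq0 => /eqP.
Qed.

Lemma quad_inj A B : (forall h, '[A h, h] = '[B h, h]) -> A = B.
Proof.
move=> AB; apply: bop_eqP => g h.
have n4 : (4 : R[i]) != 0 by rewrite pnatr_eq0.
by apply: (mulfI n4); rewrite !polarization !AB.
Qed.

(** The four terms of the polarization identity are real. Exchanging [g] and [h] swaps the two that
    carry the factor ['i], since g + i h = i (h - i g), and this has the effect of conjugation. *)
Lemma bop_ge0_herm A : bop_ge0 A -> forall g h, '[A g, h] = conjC '[A h, g].
Proof.
move=> A0 g h; have n4 : (4 : R[i]) != 0 by rewrite pnatr_eq0.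
apply: (mulfI n4); rewrite -[4 in RHS](rmorph_nat conjC) -rmorphM !polarization.
have N1 x y : '[A (x - y), x - y] = '[A (y - x), y - x].
  by rewrite -opprB bopfN innerNl innerNr opprK.
have N2 : '[A (g + 'i%R *: h), g + 'i%R *: h] = '[A (h - 'i%R *: g), h - 'i%R *: g].
  have -> : g + 'i%R *: h = 'i%R *: (h - 'i%R *: g).
    by rewrite scalerBr scalerA -expr2 sqrCi scaleN1r opprK addrC.
  by rewrite bopfZ innerZl innerZr mulrA conjCi mulrN -expr2 sqrCi opprK mul1r.
have N3 : '[A (g - 'i%R *: h), g - 'i%R *: h] = '[A (h + 'i%R *: g), h + 'i%R *: g].
  have -> : g - 'i%R *: h = - 'i%R *: (h + 'i%R *: g).
    by rewrite scaleNr scalerDr scalerA -expr2 sqrCi scaleN1r opprD opprK addrC.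
  have cN : conjC (- 'i%R) = 'i%R :> R[i] by rewrite raddfN/= conjCi opprK.
  by rewrite bopfZ innerZl innerZr mulrA cN mulNr -expr2 sqrCi opprK mul1r.
rewrite N2 N3 [g + h]addrC [in LHS]N1 rmorphD rmorphM !rmorphB/= conjCi.
rewrite !(bop_ge0E A0) !conjC_realc mulNr -mulrN opprB.
by [].
Qed.

Lemma bop1_ge0 : bop_ge0 (1 : bop H).
Proof. by move=> h; exact: dnorm_ge0. Qed.

Lemma bop_CauchySchwarz_Re A (A0 : bop_ge0 A) g h :
  complex.Re '[A g, h] ^+ 2 <= qf A g * qf A h.
Proof.
have qf0 x : 0 <= qf A x by rewrite -lecR -bop_ge0E.
apply: discr_le => // t; have := qf0 (g + t%:C *: h).
rewrite /qf bopfD bopfZ !(innerDl, innerDr, innerZl, innerZr)/= !ReD.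
rewrite [ '[A h, g] ](bop_ge0_herm A0) conjC_realc !ReZ Re_conjc.
by move/le_trans; apply; rewrite le_eqVlt; apply/orP; left; apply/eqP; ring.
Qed.

(** With [z = '[A g, h]], passing from [g] to [conjC z *: g] turns the inner product into the real
    number |z|^2 and multiplies [qf A g] by |z|^2; one factor |z|^2 then cancels. *)
Lemma bop_CauchySchwarz A (A0 : bop_ge0 A) g h :
  complex.Re `|'[A g, h]| ^+ 2 <= qf A g * qf A h.
Proof.
have qf0 x : 0 <= qf A x by rewrite -lecR -bop_ge0E.
set z := '[A g, h]; set r := complex.Re _.
have zr : `|z| = r%:C by rewrite /r RRe_real// ger0_real.
have r0 : 0 <= r by rewrite -lecR -zr normr_ge0.
have [->|rn0] := eqVneq r 0; first by rewrite expr0n mulr_ge0.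
have := bop_CauchySchwarz_Re A0 (conjC z *: g) h.
have -> : '[A (conjC z *: g), h] = (r ^+ 2)%:C.
  by rewrite bopfZ innerZl -/z mulrC -normCK zr -rmorphXn.
have -> : qf A (conjC z *: g) = r ^+ 2 * qf A g.
  rewrite /qf bopfZ innerZl innerZr conjCK mulrA [_ * z]mulrC -normCK zr.
  by rewrite -rmorphXn ReZ.
have -> : complex.Re (r ^+ 2)%:C = r ^+ 2 by [].
move=> h1; have r2 : 0 < r ^+ 2 by rewrite exprn_gt0// lt_def rn0.
by rewrite -(ler_pM2l r2) [leRHS]mulrA; exact: h1.
Qed.

Lemma qf_ge0 A (A0 : bop_ge0 A) h : 0 <= qf A h.
Proof. by rewrite -lecR -bop_ge0E. Qed.

Lemma qf1 h : qf 1 h = nrm h ^+ 2.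
Proof. by rewrite /qf inner_nrm. Qed.

Lemma inner_le x y : `|'[x, y]| <= `|x| * `|y|.
Proof.
rewrite !nrmE -[`|'[x, y]|]RRe_real ?ger0_real ?normr_ge0// -rmorphM lecR.
rewrite -(@ler_pXn2r _ 2)// ?nnegrE ?mulr_ge0 ?nrm_ge0//.
  by rewrite exprMn -!qf1; exact: (bop_CauchySchwarz bop1_ge0).
by rewrite -lecR RRe_real ?ger0_real ?normr_ge0.
Qed.

(** * The Riesz representation theorem *)

Section Riesz.
Variables (phi : H -> R[i]) (K : R).
Hypothesis phiD : forall x y, phi (x + y) = phi x + phi y.
Hypothesis phiZ : forall a x, phi (a *: x) = a * phi x.
Hypothesis phiK : forall x, `|phi x| <= K%:C * `|x|.

Let J x : R := nrm x ^+ 2 - 2 * complex.Re (phi x).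

Let nrmDZ x v (t : R) : nrm (x + t%:C *: v) ^+ 2 =
  nrm x ^+ 2 + 2 * t * complex.Re '[v, x] + t ^+ 2 * nrm v ^+ 2.
Proof.
rewrite -!qf1 /qf/= !(innerDl, innerDr, innerZl, innerZr) conjC_realc !ReD !ReZ.
by rewrite [ '[x, v] ]innerC Re_conjc; ring.
Qed.

Let JD x v (t : R) : J (x + t%:C *: v) =
  J x + 2 * t * complex.Re ('[v, x] - phi v) + t ^+ 2 * nrm v ^+ 2.
Proof. by rewrite /J nrmDZ phiD phiZ !ReD ReZ ReN; ring. Qed.

Let J_lb x : - K ^+ 2 <= J x.
Proof.
have : complex.Re (phi x) <= K * nrm x.
  rewrite -lecR rmorphM/= -nrmE (le_trans _ (phiK x))//.
  by rewrite (le_trans _ (normc_ge_Re _))// lecR ler_norm.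
have := sqr_ge0 (nrm x - K); rewrite /J; nra.
Qed.

Let m := inf (range J).

Let has_infJ : has_inf (range J).
Proof.
by split; [exists (J 0), 0|exists (- K ^+ 2) => _ [x _ <-]; exact: J_lb].
Qed.

Let m_le x : m <= J x.
Proof. by apply: ge_inf; [exact: has_infJ.2|exists x]. Qed.

Let minseq : exists u : nat -> H, forall n, J (u n) < m + n.+1%:R^-1.
Proof.
suff /choice[u hu] : forall n : nat, exists x, J x < m + n.+1%:R^-1 by exists u.
move=> n.
have [|_ [x _ <-] Jx] := @inf_adherent _ _ n.+1%:R^-1 _ has_infJ.
  by rewrite invr_gt0.
by exists x.
Qed.

(** At the midpoint [J] is the mean of [J x] and [J y] minus a quarter of [nrm (y - x) ^+ 2], and
    this is at least [m]. *)
Let nrm_parallel x y : nrm (y - x) ^+ 2 <= 2 * (J x - m) + 2 * (J y - m).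
Proof.
have := m_le (x + (2^-1)%:C *: (y - x)); rewrite JD.
have := JD x (y - x) 1; rewrite scale1r addrC subrK => ->.
lra.
Qed.

(* The representing vector minimises |x| ^ 2 - 2 Re (phi x); minimising sequences
   are Cauchy by the parallelogram identity. *)
Lemma riesz : exists y, forall x, phi x = '[x, y].
Proof.
have [u hu] := minseq.
have uc : cvg (u @ \oo).
  apply/cauchy_cvgP; apply/cauchyP => e e0.
  have eE : e = (complex.Re e)%:C by rewrite RRe_real// gtr0_real.
  set r := complex.Re e in eE; have r0 : 0 < r by rewrite -ltcR -eE.
  have [N hN] : exists N : nat, N.+1%:R^-1 < r ^+ 2 / 4.
    have h4 : 0 < r ^+ 2 / 4 by rewrite divr_gt0// exprn_gt0.
    by have [N _ /(_ N (leqnn _))] := near_infty_natSinv_lt (PosNum h4); exists N.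
  exists (u N), N => // n /= Nn; rewrite -ball_normE/= eE nrmE ltcR.
  rewrite -(@ltr_pXn2r _ 2)// ?nnegrE ?nrm_ge0 ?ltW//.
  apply: le_lt_trans (nrm_parallel _ _) _.
  have := hu n; have := hu N.
  have : n.+1%:R^-1 <= N.+1%:R^-1 :> R by rewrite lef_pV2 ?posrE// ler_nat ltnS.
  move: hN; move: n.+1%:R^-1 N.+1%:R^-1 (J (u n)) (J (u N)) m (r ^+ 2).
  by move=> a b c d m' e' *; lra.
exists (lim (u @ \oo)) => v; set y := lim _.
(* Stationarity at [y] is the limit of near-stationarity at [u n]: the discriminant of t |-> J (u n
   + t w) - m bounds the square of the first variation by (J (u n) - m) |w|^2. *)
have Re0 w : complex.Re ('[w, y] - phi w) = 0.
  apply/eqP; rewrite -normr_eq0 eq_le normr_ge0 andbT.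
  apply/ler_addgt0Pr => e e0; rewrite add0r.
  pose d := e / (2 * (nrm w + 1)).
  have w1 : 0 < nrm w + 1 by rewrite ltr_pwDr ?nrm_ge0.
  have d0 : 0 < d by rewrite divr_gt0// mulr_gt0.
  have dC : 0 < d%:C by rewrite ltcR.
  have d2 : 0 < d ^+ 2 by rewrite exprn_gt0.
  have [N1 _ hN1] : \forall n \near \oo, `|y - u n| < d%:C.
    by move/cvgrPdist_lt : uc => /(_ _ dC).
  have [N2 _ hN2] := near_infty_natSinv_lt (PosNum d2).
  pose n := maxn N1 N2.
  have {}hN1 : nrm (y - u n) < d by rewrite -ltcR -nrmE; apply: hN1;
    exact: leq_maxl.
  have {}hN2 : n.+1%:R^-1 < d ^+ 2 by apply: hN2; exact: leq_maxr.
  have D2 : complex.Re ('[w, u n] - phi w) ^+ 2 <= d ^+ 2 * nrm w ^+ 2.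
    apply: (@le_trans _ _ ((J (u n) - m) * nrm w ^+ 2)).
      apply: discr_le => [|t]; first exact: sqr_ge0.
      by have := m_le (u n + t%:C *: w); rewrite JD; lra.
    apply: ler_wpM2r; first exact: sqr_ge0.
    by rewrite lerBlDl; apply/ltW/(lt_trans (hu n)); rewrite ltrD2l.
  have D1 : `|complex.Re ('[w, u n] - phi w)| <= d * nrm w.
    have dw : 0 <= d * nrm w by apply: mulr_ge0; [exact: ltW|exact: nrm_ge0].
    rewrite -(@ler_pXn2r _ 2)// ?nnegrE//.
    by rewrite exprMn real_normK ?num_real.
  have E : complex.Re ('[w, y] - phi w) =
      complex.Re ('[w, u n] - phi w) + complex.Re '[w, y - u n].
    by rewrite innerDr innerNr !ReD !ReN; ring.
  have D3 : `|complex.Re '[w, y - u n]| <= nrm w * d.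
    rewrite -lecR (le_trans (normc_ge_Re _))// (le_trans (inner_le _ _))//.
    by rewrite !nrmE -rmorphM lecR ler_wpM2l ?nrm_ge0// ltW.
  rewrite E (le_trans (ler_normD _ _))//.
  have : e = d * (nrm w + 1) * 2 by rewrite /d; field; rewrite gt_eqF.
  have := nrm_ge0 w; nra.
(* The imaginary part at [v] is, up to sign, the real part at ['i%C *: v]. *)
have E : '[v, y] - phi v = 0.
  apply/eqP; rewrite eq_complex/= Re0 eqxx/=; have := Re0 ('i%C *: v).
  rewrite innerZl phiZ -mulrBr mulrC ReiNIm => /eqP.
  by rewrite oppr_eq0.
by apply/eqP; rewrite eq_sym -subr_eq0 E.
Qed.

End Riesz.

(** Riesz applies to [h |-> conjC (b g h)], because [b] is conjugate-linear in its second argument.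
    The representing map is bounded since |f x|^2 = b x (f x) <= K |x| |f x|. *)
Lemma bop_of_form (b : H -> H -> R[i]) (K : R) : 0 <= K ->
  (forall a x y h, b (a *: x + y) h = a * b x h + b y h) ->
  (forall a g x y, b g (a *: x + y) = conjC a * b g x + b g y) ->
  (forall g h, `|b g h| <= K%:C * `|g| * `|h|) ->
  exists A : bop H, forall g h, '[A g, h] = b g h.
Proof.
move=> K0 bl br bK.
have b0r g : b g 0 = 0.
  have := br 1 g 0 0; rewrite scaler0 addr0 rmorph1 mul1r => /eqP.
  by rewrite addrC -subr_eq subrr eq_sym => /eqP.
have [f fE] : exists f : H -> H, forall g h, '[f g, h] = b g h.
  suff /choice[f hf] : forall g, exists y, forall h, '[y, h] = b g h by exists f.
  move=> g.
  have [|||y yE] := @riesz (fun h => conjC (b g h)) (K * nrm g).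
  - by move=> x y; have := br 1 g x y; rewrite scale1r rmorph1 mul1r => ->;
    rewrite rmorphD.
  - by move=> a x; have := br a g x 0; rewrite !addr0 b0r addr0 => ->;
    rewrite rmorphM/= conjCK.
  - by move=> x; rewrite norm_conjC rmorphM/= -nrmE.
  by exists y => h; rewrite innerC -yE conjCK.
have fl : linear f.
  move=> a x y; apply/eqP; rewrite -subr_eq0 -(dnorm_eq0 inner); apply/eqP.
  rewrite {1}innerDl innerNl innerDl innerZl !fE bl; ring.
have fb : exists M : R[i], 0 <= M /\ forall x, `|f x| <= M * `|x|.
  exists K%:C; split=> [|x]; first by rewrite lecR.
  have := bK x (f x); rewrite -fE inner_nrm !nrmE ger0_norm ?lecR ?sqr_ge0//.
  rewrite -!rmorphM !lecR expr2.
  have [->|n0] := eqVneq (nrm (f x)) 0; first by rewrite mulr_ge0// nrm_ge0.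
  by rewrite ler_pM2r// lt_def n0 nrm_ge0.
by exists (Bop fl fb).
Qed.

(** The form ['[g, A h]] is represented by an operator, so the [xget] in [adj] returns a true
    adjoint and not its default. *)
Lemma adjP A x y : '[A x, y] = '[x, adj A y].
Proof.
have [M [M0 AM]] := bop_bounded A.
suff ex : exists S : bop H, forall x y, '[A x, y] = '[x, S y].
  exact: (xgetPex 0 ex).
have ME : M = (complex.Re M)%:C by rewrite RRe_real// ger0_real.
have [||||S SP] := @bop_of_form (fun g h => '[g, A h]) (complex.Re M).
- by rewrite -lecR -ME.
- by move=> a g g' h; rewrite innerDl innerZl.
- by move=> a g h h'; rewrite bopfD bopfZ innerDr innerZr.
- move=> g h; rewrite -ME (le_trans (inner_le _ _))// -mulrA mulrCA ler_wpM2l//.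
by exists S => g h; rewrite innerC -SP -innerC.
Qed.

Lemma adj_unique A (S : bop H) : (forall x y, '[A x, y] = '[x, S y]) -> adj A = S.
Proof. 
by move=> h; apply: bop_eqP => x y; rewrite innerC -adjP h innerC conjCK.
Qed.

Lemma Re_norm_ge0 (z : R[i]) : 0 <= complex.Re `|z|.
Proof. by rewrite -lecR RRe_real ?ger0_real ?normr_ge0. Qed.

Lemma cvg_complexP (u : nat -> R[i]^o) (l : R[i]^o) :
  (fun n => complex.Re (u n)) @ \oo --> complex.Re l ->
  (fun n => complex.Im (u n)) @ \oo --> complex.Im l -> u @ \oo --> l.
Proof.
move=> ur ui; apply/cvgrPdist_lt => e e0.
have eE : e = (complex.Re e)%:C by rewrite RRe_real// gtr0_real.
have r0 : 0 < complex.Re e / 2 by rewrite divr_gt0// -ltcR -eE.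
move/cvgrPdist_lt : ur => /(_ _ r0); move/cvgrPdist_lt : ui => /(_ _ r0).
apply: filterS2 => n hi hr; rewrite [l - u n]complexE (le_lt_trans (ler_normD _
  _))//.
rewrite normrM complexiE normCi mul1r.
rewrite !normc_def/= !expr0n !addr0 !sqrtr_sqr -rmorphD eE ltcR.
have -> : complex.Re (l - u n) = complex.Re l - complex.Re (u n) by rewrite ReD ReN.
have -> : complex.Im (l - u n) = complex.Im l - complex.Im (u n).
  by case: (l) (u n) => ? ? [].
by rewrite [X in _ < X]splitr ltrD.
Qed.

(** The limit is written by polarization of [q], which at this stage is only a pointwise limit and
    not yet the form of an operator. *)
Lemma quad_cvg (A : nat -> bop H) (q : H -> R[i]) :
  (forall h, (fun n => '[A n h, h] : R[i]^o) @ \oo --> (q h : R[i]^o)) ->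
  forall g h, (fun n => '[A n g, h] : R[i]^o) @ \oo -->
    (4^-1 * ((q (g + h) - q (g - h)) +
      'i%R * (q (g + 'i%R *: h) - q (g - 'i%R *: h))) : R[i]^o).
Proof.
move=> Aq g h.
have n4 : (4 : R[i]) != 0 by rewrite pnatr_eq0.
have E n : '[A n g, h] = 4^-1 * (('[A n (g + h), g + h] - '[A n (g - h), g - h]) +
  'i%R * ('[A n (g + 'i%R *: h), g + 'i%R *: h] -
          '[A n (g - 'i%R *: h), g - 'i%R *: h])) :> R[i]^o.
  by rewrite -polarization mulrA mulVf// mul1r.
under eq_fun do rewrite E; apply: cvgM; first exact: cvg_cst.
apply: cvgD; first by apply: cvgB; exact: Aq.
by apply: cvgM; [exact: cvg_cst|apply: cvgB; exact: Aq].
Qed.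

Lemma bop_ge0_cvg (A : nat -> bop H) (q : H -> R) : (forall n, bop_ge0 (A n)) ->
  (forall h, (fun n => qf (A n) h) @ \oo --> q h) ->
  forall h, (fun n => '[A n h, h] : R[i]^o) @ \oo --> ((q h)%:C : R[i]^o).
Proof.
move=> A0 Aq h; apply: cvg_complexP => //=.
  by under eq_fun do rewrite (bop_ge0E (A0 _))/=; exact: Aq.
by under eq_fun do rewrite (bop_ge0E (A0 _))/=; exact: cvg_cst.
Qed.

Lemma weak_cvg (A : nat -> bop H) (B : bop H) : (forall n, bop_ge0 (A n)) ->
  bop_ge0 B -> (forall h, (fun n => qf (A n) h) @ \oo --> qf B h) ->
  forall g h, (fun n => '[A n g, h] : R[i]^o) @ \oo --> ('[B g, h] : R[i]^o).
Proof.
move=> A0 B0 Aq g h; have n4 : (4 : R[i]) != 0 by rewrite pnatr_eq0.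
have <- : 4^-1 * (('[B (g + h), g + h] - '[B (g - h), g - h]) +
    'i%R * ('[B (g + 'i%R *: h), g + 'i%R *: h] -
            '[B (g - 'i%R *: h), g - 'i%R *: h])) = '[B g, h].
  by rewrite -polarization mulrA mulVf// mul1r.
apply: (@quad_cvg A (fun h => '[B h, h])) => x /=.
by rewrite (bop_ge0E B0); exact: (bop_ge0_cvg A0 Aq).
Qed.

(** The sesquilinear forms converge by polarization. Cauchy-Schwarz for the positive [A n] bounds
    them by K |g| |h| uniformly in [n], the limit form inherits the bound, and [bop_of_form]
    represents it. *)
Lemma bop_lim (A : nat -> bop H) (K : R) (q : H -> R) : 0 <= K ->
  (forall n, bop_ge0 (A n)) -> (forall n h, qf (A n) h <= K * nrm h ^+ 2) ->
  (forall h, (fun n => qf (A n) h) @ \oo --> q h) ->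
  exists2 B : bop H, bop_ge0 B & forall h, qf B h = q h.
Proof.
move=> K0 A0 AK Aq.
have cvgAq := bop_ge0_cvg A0 Aq.
have cvgA g h : cvg ((fun n => '[A n g, h] : R[i]^o) @ \oo).
  by apply: cvgP; exact: (@quad_cvg A (fun h => (q h)%:C) cvgAq g h).
pose b g h : R[i] := lim ((fun n => '[A n g, h] : R[i]^o) @ \oo).
have bE g h : (fun n => '[A n g, h] : R[i]^o) @ \oo --> (b g h : R[i]^o) by
  exact: cvgA.
have uniq (u : nat -> R[i]^o) (l m : R[i]^o) : u @ \oo --> l -> u @ \oo --> m ->
  l = m.
  by move=> ul um; exact: (cvg_unique (@norm_hausdorff _ R[i]^o) ul um).
have [|||B BE] := @bop_of_form b K K0.
- move=> a x y h; apply: uniq (bE _ _) _.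
  under eq_fun do rewrite bopfD bopfZ innerDl innerZl.
  by apply: cvgD; [apply: cvgM; [exact: cvg_cst|exact: bE]|exact: bE].
- move=> a g x y; apply: uniq (bE _ _) _.
  under eq_fun do rewrite innerDr innerZr.
  by apply: cvgD; [apply: cvgM; [exact: cvg_cst|exact: bE]|exact: bE].
- move=> g h; have /(cvg_norm (V := R[i]^o)) bn := bE g h.
  rewrite !nrmE -[`|b g h|]RRe_real ?ger0_real ?normr_ge0// -!rmorphM lecR.
  apply: (cvgr_to_le (Re_cvg bn)); apply: nearW => n /=.
  rewrite -(@ler_pXn2r _ 2)// ?nnegrE ?mulr_ge0 ?nrm_ge0//; last first.
    exact: Re_norm_ge0.
  apply: le_trans (bop_CauchySchwarz (A0 n) g h) _.
  rewrite [leRHS](_ : _ = (K * nrm g ^+ 2) * (K * nrm h ^+ 2)); last by ring.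
  by rewrite ler_pM ?qf_ge0.
exists B => [h|h].
  rewrite BE (uniq _ _ _ (bE h h) (cvgAq h)) lecR.
  by apply: (cvgr_to_ge (Aq h)); apply: nearW => n; exact: qf_ge0.
by rewrite /qf BE (uniq _ _ _ (bE h h) (cvgAq h)).
Qed.

Lemma qf_bounded A : exists2 K, 0 <= K & forall h, qf A h <= K * nrm h ^+ 2.
Proof.
have [M [M0 AM]] := bop_bounded A.
have ME : M = (complex.Re M)%:C by rewrite RRe_real// ger0_real.
exists (complex.Re M) => [|h]; first by rewrite -lecR -ME.
rewrite -lecR rmorphM/= -ME rmorphXn/= -nrmE expr2 mulrA.
apply: le_trans (_ : `|'[A h, h]| <= _).
  by rewrite (le_trans _ (normc_ge_Re _))// lecR ler_norm.
by rewrite (le_trans (inner_le _ _))// ler_wpM2r.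
Qed.

Lemma qfD A B h : qf (A + B) h = qf A h + qf B h.
Proof. by rewrite /qf/= innerDl ReD. Qed.

Lemma qfN A h : qf (- A) h = - qf A h.
Proof. by rewrite /qf/= innerNl ReN. Qed.

Lemma qf0 h : qf 0 h = 0.
Proof. by rewrite -(subrr 0) qfD qfN subrr. Qed.

Lemma qfMn A n h : qf (A *+ n) h = qf A h *+ n.
Proof. by elim: n => [|n IH]; rewrite ?mulr0n ?qf0// !mulrS qfD IH. Qed.

Lemma qfZ (a : R) A h : qf (a%:C *: A) h = a * qf A h.
Proof. by rewrite /qf/= innerZl ReZ. Qed.

Lemma qf_sum I (r : seq I) (P : pred I) (A : I -> bop H) h :
  qf (\sum_(i <- r | P i) A i) h = \sum_(i <- r | P i) qf (A i) h.
Proof. by elim/big_rec2: _ => [|i a b _ <-]; rewrite ?qf0 ?qfD. Qed.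

Lemma bop_ge0D A B : bop_ge0 A -> bop_ge0 B -> bop_ge0 (A + B).
Proof. by move=> A0 B0 h; rewrite /= innerDl addr_ge0. Qed.

Lemma bop_ge0Z (a : R) A : 0 <= a -> bop_ge0 A -> bop_ge0 (a%:C *: A).
Proof. by move=> a0 A0 h; rewrite /= innerZl mulr_ge0// lecR. Qed.

Lemma bop_ge00 : bop_ge0 (0 : bop H).
Proof. by move=> h; rewrite /= (linear0l inner). Qed.

Lemma bop_ge0_sum I (r : seq I) (P : pred I) (A : I -> bop H) :
  (forall i, P i -> bop_ge0 (A i)) -> bop_ge0 (\sum_(i <- r | P i) A i).
Proof.
by move=> A0; elim/big_rec: _ => [|i a Pi]; [exact: bop_ge00|apply: bop_ge0D;
  exact: A0].
Qed.

Lemma qf_inj A B : bop_ge0 A -> bop_ge0 B -> (forall h, qf A h = qf B h) -> A = B.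
Proof. by move=> A0 B0 AB; apply: quad_inj => h; rewrite !bop_ge0E// AB. Qed.

End Hilbert.

(** * Polynomials on a compact interval *)

Section PolynomialCone.
Context {R : realType}.
Implicit Types (p q : {poly R}).

(** Division by ['X - c%:P] gives no information on the sign of the quotient at [c] itself;
    continuity recovers it. *)
Lemma horner_ge0_adherent q (c : R) :
  (forall d, 0 < d -> exists x, `|c - x| < d /\ 0 <= q.[x]) -> 0 <= q.[c].
Proof.
move=> h; rewrite leNgt; apply/negP => qc.
have /cvgrPdist_lt/(_ (- q.[c])) := @continuous_horner _ q c.
rewrite oppr_gt0 => /(_ qc)[d /= d0 hd].
have [x [xd qx]] := h _ d0.
have := hd x xd => /=; rewrite ltNge => /negP; apply.
have h0 : q.[c] - q.[x] <= 0 by rewrite subr_le0 (le_trans (ltW qc)).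
by rewrite ler0_norm// opprB lerDr.
Qed.

Variables (rho : R) (P : {poly R} -> Prop).
Hypothesis rho0 : 0 < rho.
Hypothesis PC : forall c, 0 <= c -> P c%:P.
Hypothesis PD : forall p q, P p -> P q -> P (p + q).
Hypothesis PS : forall p c, P p -> P (p * ('X - c%:P) ^+ 2).
Hypothesis PX : forall p, P p -> P (p * 'X).
Hypothesis PB : forall p, P p -> P (p * (rho%:P - 'X)).

(* Subtract the minimum p.[c] of p and divide by X - c: the quotient is divisible
   by X - c again if c is interior, and has constant sign if c is an endpoint. *)
Lemma poly_ge0_itv_ind p : (forall x, 0 <= x <= rho -> 0 <= p.[x]) -> P p.
Proof.
have [n] := ubnP (size p); elim: n p => // n IH p pn p0.
have [p1|p1] := leqP (size p) 1.
  rewrite (size1_polyC p1); apply: PC.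
  by have := p0 0; rewrite lexx ltW// (size1_polyC p1) hornerC coefC/=; apply.
have cp : {within `[0, rho], continuous (horner p)}.
  by apply: continuous_subspaceT => x; exact: continuous_horner.
have [c cI pmin] := EVT_min (ltW rho0) cp.
have {}pmin x : 0 <= x <= rho -> p.[c] <= p.[x] by move=> xI; apply: pmin;
  rewrite in_itv.
move: cI; rewrite in_itv/= => /andP[c0 crho].
have m0 : 0 <= p.[c] by rewrite p0// c0.
have [q pq] : exists q, p - p.[c]%:P = q * ('X - c%:P).
  by apply/factor_theorem; rewrite /root !hornerE subrr.
have pE : p = q * ('X - c%:P) + p.[c]%:P by rewrite -pq subrK.
have qn0 : q != 0.
  by apply: contraTneq p1 => q0; rewrite pE q0 mul0r add0r -leqNgt size_polyC_leq1.
have sizeMX r : r != 0 -> size (r * ('X - c%:P)) = (size r).+1.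
  by move=> r0; rewrite size_Mmonic ?monicXsubC// size_XsubC addn2.
have sq : (size q < n)%N.
  rewrite -sizeMX// -pq -ltnS (leq_ltn_trans _ pn)//.
  by rewrite (leq_trans (size_polyD _ _))//
    size_polyN geq_max leqnn (leq_trans (size_polyC_leq1 _))// ltnW.
have qx x : 0 <= x <= rho -> 0 <= q.[x] * (x - c).
  by move=> xI; have := pmin x xI; rewrite {2}pE !hornerE lerDr.
have [c00|cn0] := eqVneq c 0.
  rewrite pE c00 subr0; apply: PD; last by apply: PC; move: m0; rewrite c00.
  apply: PX; apply: IH => // x /andP[x0 xrho].
  have [xgt|xle] := ltP 0 x.
    by have := qx x; rewrite x0 xrho c00 subr0 pmulr_lge0//; apply.
  have {xle x0}-> : x = 0 by apply/eqP; rewrite eq_le x0 xle.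
  apply: horner_ge0_adherent => d d0; pose y := Num.min (d / 2) rho.
  have y0 : 0 < y by rewrite lt_min divr_gt0.
  exists y; rewrite sub0r normrN gtr0_norm//; split.
    by rewrite gt_min; apply/orP; left; rewrite ltr_pdivrMr//
      mulr_natr mulr2n ltrDl.
  by have := qx y; rewrite (ltW y0) ge_min lexx orbT c00 subr0 pmulr_lge0//; apply.
have {cn0}c0 : 0 < c by rewrite lt_def cn0.
have left d : 0 < d -> exists x, [/\ `|c - x| < d, 0 <= x <= rho & x < c].
  move=> d0; pose y := Num.min (d / 2) c; exists (c - y).
  have y0 : 0 < y by rewrite lt_min divr_gt0.
  rewrite subKr gtr0_norm// ltrBlDr ltrDl y0 subr_ge0 ge_min lexx orbT/=.
  rewrite (le_trans _ crho) ?gerBl ?(ltW y0)//; split=> //.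
  by rewrite gt_min; apply/orP; left; rewrite ltr_pdivrMr// mulr_natr mulr2n ltrDl.
have qle x : 0 <= x <= rho -> x < c -> 0 <= (- q).[x].
  by move=> xI xc; have := qx x xI; rewrite nmulr_lge0 ?subr_lt0// hornerN oppr_ge0.
have qle_c : 0 <= (- q).[c].
  apply: horner_ge0_adherent => d /left[x [xd xI xc]].
  by exists x; split=> //; exact: qle.
have [crhoE|cnrho] := eqVneq c rho.
  rewrite pE crhoE -opprB mulrN -mulNr; apply: PD; last by apply: PC; move: m0;
    rewrite crhoE.
  apply: PB; apply: IH; first by rewrite size_polyN.
  move=> x xI; have [xc|xc] := ltP x c; first exact: qle.
  suff -> : x = c by [].
  by apply/eqP; rewrite eq_le xc crhoE; case/andP: xI => _ ->.
have {cnrho}crho' : c < rho by rewrite lt_def eq_sym cnrho.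
have right d : 0 < d -> exists x, [/\ `|c - x| < d, 0 <= x <= rho & c < x].
  move=> d0; pose y := Num.min (d / 2) (rho - c); exists (c + y).
  have y0 : 0 < y by rewrite lt_min divr_gt0//= subr_gt0.
  rewrite opprD addNKr normrN gtr0_norm// ltrDl y0 addr_ge0 ?(ltW y0) ?(ltW c0)//=.
  rewrite addrC -lerBrDr ge_min lexx orbT; split=> //.
  by rewrite gt_min; apply/orP; left; rewrite ltr_pdivrMr// mulr_natr mulr2n ltrDl.
have qge x : 0 <= x <= rho -> c < x -> 0 <= q.[x].
  by move=> xI xc; have := qx x xI; rewrite pmulr_lge0 ?subr_gt0.
(* The quotient is nonpositive to the left of an interior minimum and nonnegative to its right. *)
have qc : q.[c] = 0.
  apply/eqP; rewrite eq_le -oppr_ge0 -hornerN qle_c/=.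
  apply: horner_ge0_adherent => d /right[x [xd xI xc]].
  by exists x; split=> //; exact: qge.
have [r qr] : exists r, q = r * ('X - c%:P).
  by apply/factor_theorem; rewrite /root qc.
have rn0 : r != 0 by apply: contraNneq qn0 => r0; rewrite qr r0 mul0r.
rewrite pE qr -mulrA -expr2; apply: PD; last exact: PC.
apply: PS; apply: IH; first by rewrite (leq_trans _ sq)// qr sizeMX// ltnS ltnW.
have rx x : 0 <= x <= rho -> x != c -> 0 <= r.[x].
  move=> xI xc; have := qx x xI; rewrite qr !hornerE -mulrA -expr2 pmulr_lge0//.
  by rewrite exprn_even_gt0//= subr_eq0.
move=> x xI; have [->|xc] := eqVneq x c; last exact: rx.
apply: horner_ge0_adherent => d /right[y [yd yI yc]].
by exists y; split=> //; apply: rx => //; rewrite gt_eqF.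
Qed.

End PolynomialCone.

(** * Polynomials close to indicators of half-lines *)

Section StepPolynomials.
Context {R : realType}.

Lemma bernoulli_le (u : R) n : 0 <= u <= 1 -> 1 - u *+ n <= (1 - u) ^+ n.
Proof.
move=> /andP[u0 u1]; elim: n => [|n IH]; first by rewrite mulr0n subr0 expr0.
rewrite exprS (le_trans _ (ler_wpM2l _ IH)) ?subr_ge0// mulrSr.
have : 0 <= u * (u *+ n) by rewrite mulr_ge0// mulrn_wge0.
by nra.
Qed.

(** The bound (1 - u)^n <= 1 / (1 + n u) without division; the induction uses (1 - u) (1 + (n + 1)
    u) <= 1 + n u. *)
Lemma bernoulli_inv (u : R) n : 0 <= u <= 1 -> (1 - u) ^+ n * (1 + u *+ n) <= 1.
Proof.
move=> /andP[u0 u1]; elim: n => [|n IH]; first by rewrite mulr0n addr0 expr0 mul1r.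
apply: le_trans IH; rewrite exprSr -mulrA ler_wpM2l ?exprn_ge0 ?subr_ge0// mulrSr.
have : 0 <= u * (u *+ n) by rewrite mulr_ge0// mulrn_wge0.
by nra.
Qed.

(* The witness is (1 - (x / rho) ^ n) ^ K with (b / a) ^ n large and K of the order of
   (rho / b) ^ n / e, as in the Brosowski-Deutsch proof of Stone-Weierstrass. *)
Lemma step_poly (rho a b e : R) : 0 < rho -> a < b -> 0 < e ->
  exists p : {poly R}, forall x, 0 <= x <= rho ->
    [/\ 0 <= p.[x], p.[x] <= 1, x <= a -> 1 - e <= p.[x] & b <= x -> p.[x] <= e].
Proof.
move=> rho0 ab e0.
have [rb|br] := ltP rho b.
  exists 1 => x /andP[_ xr]; rewrite hornerC ler01 lexx; split=> // [_|bx].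
    by rewrite gerBl ltW.
  by have := lt_le_trans (le_lt_trans xr rb) bx; rewrite ltxx.
have [e1|e1] := leP 1 e.
  exists 0 => x _; rewrite horner0 ler01 lexx; split=> // _; last exact: ltW.
  by rewrite subr_le0.
have [a0|a0] := ltP a 0.
  exists 0 => x /andP[x0 _]; rewrite horner0 ler01 lexx; split=> // [xa|_].
    by have := le_lt_trans xa (lt_le_trans a0 x0); rewrite ltxx.
  exact: ltW.
have b0 : 0 < b by exact: le_lt_trans ab.
have [n zn] : exists n, (a / b) ^+ n < e ^+ 2 / 2.
  apply: expr_lt_ex; last by rewrite divr_gt0// exprn_gt0.
  by rewrite divr_ge0 ?(ltW b0)//= ltr_pdivrMr// mul1r.
pose B := (b / rho) ^+ n; pose A := (a / rho) ^+ n.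
have B0 : 0 < B by rewrite exprn_gt0// divr_gt0.
have B1 : B <= 1 by rewrite exprn_ile1 ?divr_ge0 ?(ltW b0) ?(ltW rho0)//
  ler_pdivrMr// mul1r.
have AB : A < e ^+ 2 / 2 * B.
  by rewrite -ltr_pdivrMr// /A /B -expr_div_n; congr (_ ^+ _ < _): zn; field;
    rewrite !gt_eqF.
(* [K] lies between 1 / (e B) and 2 / (e B). The lower bound gives K B >= 1 / e, hence small values
   beyond [b]; the upper one and A < e^2 B / 2 give A K <= e, hence values near 1 before [a]. *)
pose y := (e * B)^-1.
have eB0 : 0 < e * B by rewrite mulr_gt0.
have y1 : 1 <= y by rewrite invf_ge1// mulr_ile1// ltW.
have /andP[Ky yK] : ((Num.truncn y)%:R <= y < (Num.truncn y).+1%:R).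
  by apply: truncn_itv; rewrite (le_trans ler01).
set K := (Num.truncn y).+1 in yK.
have K2 : K%:R <= 2 / (e * B) by rewrite /K -natr1 -/y; lra.
exists ((1 - (rho^-1 *: 'X) ^+ n) ^+ K) => x /andP[x0 xr].
rewrite !(horner_exp, hornerE).
set u := (_ * x) ^+ n.
have uI : 0 <= u <= 1.
  rewrite exprn_ge0 ?mulr_ge0 ?invr_ge0 ?(ltW rho0)//= exprn_ile1//.
    by rewrite mulr_ge0 ?invr_ge0 ?(ltW rho0).
  by rewrite mulrC ler_pdivrMr// mul1r.
have /andP[u0 u1] := uI.
split; first by rewrite exprn_ge0// subr_ge0.
- by rewrite exprn_ile1 ?subr_ge0// gerBl.
- move=> xa; apply: le_trans (bernoulli_le K uI); rewrite lerB// -mulr_natr.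
  have uA : u <= A.
    rewrite /u /A lerXn2r ?nnegrE ?mulr_ge0 ?invr_ge0 ?(ltW rho0)// [_ * x]mulrC.
    by rewrite ler_wpM2r// invr_ge0 ltW.
  rewrite (le_trans (ler_wpM2r _ uA))//.
  have : A * K%:R <= e ^+ 2 / 2 * B * (2 / (e * B)).
    by rewrite ler_pM// ?(ltW AB)// (le_trans _ uA).
  move/le_trans; apply; rewrite le_eqVlt; apply/orP; left; apply/eqP; field.
  by rewrite !gt_eqF.
- move=> bx; have uB : B <= u.
    rewrite /u /B lerXn2r ?nnegrE ?mulr_ge0 ?invr_ge0 ?(ltW rho0) ?(ltW b0)//
      [_ * x]mulrC.
    by rewrite ler_wpM2r// invr_ge0 ltW.
  have h := bernoulli_inv K uI.
  have : e^-1 <= 1 + u *+ K.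
    have : y * B <= K%:R * u by apply: ler_pM => //;
      [exact: le_trans ler01 y1|exact: ltW|exact: ltW].
    rewrite (_ : y * B = e^-1) ?mulr_natl; first by lra.
    by rewrite /y; field; rewrite !gt_eqF.
  move=> h2; have := ler_wpM2l (exprn_ge0 K (_ : 0 <= 1 - u)) h2.
  rewrite subr_ge0 => /(_ u1)/le_trans/(_ h).
  by rewrite ler_pdivrMr// mul1r.
Qed.

End StepPolynomials.

(** * Functionals nonnegative on an interval *)

Section PositiveFunctional.
Context {R : realType}.
Variables (s : nat -> R) (C rho : R).
Hypothesis rho0 : 0 < rho.
Hypothesis pos : forall q, 0 <= mom s (q ^+ 2).
Hypothesis posX : forall q, 0 <= mom s (q ^+ 2 * 'X).
Hypothesis growth : forall n, `|s n| <= C * rho ^+ n.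

(** Positivity of [mom s p] alone is not stable under multiplication of [p] by X or rho - X. The
    invariant [P] therefore tests [p] against the three weights q^2, q^2 X and q^2 (rho - X); [XE]
    brings the mixed product X (rho - X) back to them. *)
Lemma mom_ge0_itv p : (forall x, 0 <= x <= rho -> 0 <= p.[x]) -> 0 <= mom s p.
Proof.
move=> p0; pose P p := forall q, [/\ 0 <= mom s (q ^+ 2 * p),
    0 <= mom s (q ^+ 2 * 'X * p) & 0 <= mom s (q ^+ 2 * (rho%:P - 'X) * p)].
suff /(_ 1)[] : P p by rewrite expr1n mul1r.
have XE (q r : {poly R}) : (q ^+ 2 * (rho%:P - 'X) * ('X * r)) =
   rho^-1 *: ((q * 'X) ^+ 2 * (rho%:P - 'X) * r
           + (q * (rho%:P - 'X)) ^+ 2 * 'X * r).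
  transitivity (rho^-1 *: (rho%:P * (q ^+ 2 * (rho%:P - 'X) * ('X * r)))).
    by rewrite mul_polyC scalerA mulVf ?gt_eqF// scale1r.
  by congr (_ *: _); ring.
apply: (@poly_ge0_itv_ind _ rho P rho0) p0 =>
  {p} [c c0 q|p r hp hr q|p c hp q|p hp q|p hp q].
- rewrite ![_ * c%:P]mulrC !mul_polyC !linearZ/=.
  split; apply: mulr_ge0 => //. exact: (mom_pos_sub rho0 pos posX growth).
- have [p1 p2 p3] := hp q; have [r1 r2 r3] := hr q.
  by rewrite ![_ * (p + r)]mulrDr !linearD/=; split; apply: addr_ge0.
- have [p1 p2 p3] := hp (q * ('X - c%:P)).
  by split; [move: p1|move: p2|move: p3]; congr (0 <= mom s _); ring.
- have [p1 p2 p3] := hp q; have [r1 r2 r3] := hp (q * 'X).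
  have [t1 t2 t3] := hp (q * (rho%:P - 'X)).
  split; [move: p2|move: r1|]; rewrite ?[p * 'X]mulrC ?XE.
  + by congr (0 <= mom s _); ring.
  + by congr (0 <= mom s _); ring.
  + by rewrite linearZ/= mulr_ge0 ?invr_ge0 ?(ltW rho0)// linearD addr_ge0.
- have [p1 p2 p3] := hp q; have [r1 r2 r3] := hp (q * 'X).
  have [t1 t2 t3] := hp (q * (rho%:P - 'X)).
  have XE' : (q ^+ 2 * 'X * (p * (rho%:P - 'X))) = q ^+ 2 * (rho%:P - 'X) * ('X
    * p) by ring.
  split; [move: p3| |move: t1]; rewrite ?XE' ?XE.
  + by congr (0 <= mom s _); ring.
  + by rewrite linearZ/= mulr_ge0 ?invr_ge0 ?(ltW rho0)// linearD addr_ge0.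
  + by congr (0 <= mom s _); ring.
Qed.

End PositiveFunctional.

(** * Functionals sharing a distribution function *)

Section StieltjesComparison.
Context {R : realType}.
Variables (rho K : R) (G : R -> R).
Hypothesis rho0 : 0 < rho.
Implicit Types (L : {scalar {poly R}}).

Definition positive_on L := forall p : {poly R},
  (forall x, 0 <= x <= rho -> 0 <= p.[x]) -> 0 <= L p.

(* L integrates the indicator function of ]-oo, x] to G x, up to jumps *)
Definition has_cdf L := forall e : R, 0 < e -> forall (y : R) (p : {poly R}),
  ((forall x, 0 <= x <= rho -> p.[x] <= (x <= y)%R%:R + e) -> L p <= G y + e * K) /\
  ((forall x, 0 <= x <= rho -> (x <= y)%R%:R - e <= p.[x]) -> G y <= L p + e * K).

Lemma positive_le L p q : positive_on L ->
  (forall x, 0 <= x <= rho -> p.[x] <= q.[x]) -> L p <= L q.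
Proof.
move=> Lp pq; rewrite -subr_ge0 -linearB; apply: Lp => x xI.
by rewrite hornerD hornerN subr_ge0 pq.
Qed.

(** A Stieltjes sum: rho^n - x^n is nonincreasing on [[0, rho]], hence up to the mesh a combination
    of indicators of ]-oo, x_i] with nonnegative weights, and on polynomials near these indicators
    [has_cdf] compares both functionals with [G]. *)
Lemma cdf_le L1 L2 n : L1 1 <= K -> L2 1 <= K ->
  positive_on L1 -> positive_on L2 -> has_cdf L1 -> has_cdf L2 ->
  L1 ((rho ^+ n)%:P - 'X^n) <= L2 ((rho ^+ n)%:P - 'X^n).
Proof.
move=> L1K L2K p1 p2 c1 c2.
have K0 : 0 <= K by rewrite (le_trans _ L1K)// p1// => x _; rewrite hornerC.
(* The estimates evaluate [g] at [t - 3 * eta], which may be negative, so the polynomial is extended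
   by constants outside [[0, rho]]. *)
pose clamp (x : R) : R := Num.max 0 (Num.min x rho).
have clampE x : 0 <= x <= rho -> clamp x = x.
  by move=> /andP[x0 xr]; rewrite /clamp min_l// max_r.
have clampI x : 0 <= clamp x <= rho.
  by rewrite /clamp le_max lexx/= ge_max ltW// ge_min lexx orbT.
have clamp_mono x y : x <= y -> clamp x <= clamp y.
  move=> xy; rewrite /clamp ge_max !le_max lexx/=; apply/orP.
  have [y0|y0] := leP 0 (Num.min y rho); last by left;
    rewrite ltW// (le_lt_trans _ y0)// le_min !ge_min xy lexx orbT.
  by right; rewrite le_min !ge_min xy lexx orbT.
have clamp_lip x d : 0 <= d -> clamp x - clamp (x - d) <= d.
  move=> d0; rewrite lerBlDr /clamp ge_max; apply/andP; split.
    by rewrite addr_ge0// le_max lexx.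
  rewrite addrC -lerBlDr le_max; apply/orP; right;
    rewrite le_min lerB ?ge_min ?lexx//=.
  by rewrite lerBlDr (le_trans (_ : _ <= rho)) ?ge_min ?lexx ?orbT// lerDl.
pose g x := rho ^+ n - clamp x ^+ n.
have g_mono x y : x <= y -> g y <= g x.
  by move=> xy; rewrite lerB// lerXn2r ?nnegrE ?clamp_mono//;
    case/andP: (clampI x); case/andP: (clampI y).
have g0 x : 0 <= g x.
  by rewrite subr_ge0 lerXn2r ?nnegrE ?(ltW rho0)//; case/andP: (clampI x).
pose D := n%:R * rho ^+ n.-1.
have g_lip x d : 0 <= d -> g (x - d) - g x <= d * D.
  move=> d0; have -> : g (x - d) - g x = clamp x ^+ n - clamp (x - d) ^+ n.
    by rewrite /g; ring.
  have [/andP[a0 ar] /andP[b0 br]] := (clampI x, clampI (x - d)).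
  rewrite subrXX ler_pM ?clamp_lip ?subr_ge0 ?clamp_mono ?gerBl//.
    by apply: sumr_ge0 => i _; rewrite mulr_ge0 ?exprn_ge0.
  have -> : D = \sum_(i < n) rho ^+ n.-1 by rewrite sumr_const card_ord -mulr_natl.
  rewrite ler_sum// => i _.
  have iE : (n.-1 - i + i = n.-1)%N.
    by rewrite subnK// -ltnS prednK// (leq_ltn_trans _ (ltn_ord i)).
  by rewrite -[in leRHS]iE exprD ler_pM ?exprn_ge0// lerXn2r ?nnegrE ?(ltW rho0).
have gpoly x : 0 <= x <= rho -> ((rho ^+ n)%:P - 'X^n).[x] = g x.
  by move=> xI; rewrite !hornerE /g clampE.
pose B := rho ^+ n.
apply/ler_addgt0Pr => e e0.
have D0 : 0 <= D by rewrite mulr_ge0 ?exprn_ge0 ?(ltW rho0).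
have [N hN] : exists N : nat, 6 * rho * D * K / e < N.+1%:R.
  have y0 : 0 <= 6 * rho * D * K / e.
    rewrite divr_ge0 ?(ltW e0)//; apply: mulr_ge0 => //; apply: mulr_ge0 => //.
    by rewrite mulr_ge0// ltW.
  by exists (Num.truncn (6 * rho * D * K / e)); have /andP[] := truncn_itv y0.
pose eta := rho / N.+1%:R.
have eta0 : 0 < eta by rewrite divr_gt0.
have etaE : 3 * eta * D * K <= e / 2.
  move: hN; rewrite ltr_pdivrMr// => /ltW hN.
  rewrite (_ : 3 * _ * _ * _ = (6 * rho * D * K) / (2 * N.+1%:R)); last first.
    by rewrite /eta; field; rewrite gt_eqF.
  by rewrite ler_pdivrMr// (le_trans hN)// le_eqVlt; apply/orP; left; apply/eqP;
    field.
pose x_ (i : nat) := i%:R * eta.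
have x_S i : x_ i.+1 = x_ i + eta by rewrite /x_ -natr1 mulrDl mul1r.
pose c i := g (x_ i) - g (x_ i.+1).
have c0 i : 0 <= c i by rewrite subr_ge0 g_mono// x_S lerDl ltW.
have x_N : x_ N.+1 = rho by rewrite /x_ /eta mulrC divfK.
have tel (h : R -> R) : \sum_(i < N.+1) (h (x_ i) - h (x_ i.+1)) = h 0 - h rho.
  rewrite -(big_mkord xpredT (fun i => h (x_ i) - h (x_ i.+1))).
  under eq_bigr do rewrite -opprB.
  by rewrite sumrN telescope_sumr// opprB x_N /x_ mul0r.
have g_le x : g x <= B by rewrite gerBl exprn_ge0//; case/andP: (clampI x).
have sumc : \sum_(i < N.+1) c i <= B.
  by rewrite tel (le_trans _ (g_le 0))// gerBl.
have B0 : 0 < B by rewrite exprn_gt0.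
(* The total error is [3 * eta * D * K + 4 * d * B * K]; the choices of [N] and [d] make each term
   at most [e / 2]. The summand 1 covers [K = 0]. *)
pose d := e / (8 * B * (K + 1)).
have d0 : 0 < d by rewrite divr_gt0// !mulr_gt0// ltr_pwDr.
(* Weighted by the decrements of g, the indicators of t <= x_(i+k) telescope to
   g (t - k eta) up to one step. *)
have step_lb t : 0 <= t <= rho -> g t <= \sum_(i < N.+1) c i * (t <= x_ i.+1)%R%:R.
  move=> /andP[t0 tr]; have <- : g (Num.max 0 t) - g (Num.max rho t) = g t.
    by rewrite (max_r t0) (max_l tr) {2}/g clampE ?subrr ?subr0// lexx ltW.
  rewrite -(tel (fun x => g (Num.max x t))) ler_sum// => i _.
  have xi : x_ i <= x_ i.+1 by rewrite x_S lerDl ltW.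
  have [h|h] := leP t (x_ i.+1).
    by rewrite mulr1 lerB// g_mono// le_max lexx.
  by rewrite (max_r (ltW (le_lt_trans xi h))) subrr mulr0.
have step_ub t : \sum_(i < N.+1) c i * (t <= x_ i)%R%:R <= g t.
  apply: (@le_trans _ _ (g (Num.max 0 t) - g (Num.max rho t))); last first.
    apply: (@le_trans _ _ (g (Num.max 0 t))); first by rewrite gerBl.
    by rewrite g_mono// le_max lexx orbT.
  rewrite -(tel (fun x => g (Num.max x t))) ler_sum// => i _.
  have xi : x_ i <= x_ i.+1 by rewrite x_S lerDl ltW.
  have [h|h] := leP t (x_ i).
    by rewrite mulr1 (max_l (le_trans h xi)).
  by rewrite mulr0 subr_ge0 g_mono// le_max lexx orbT.
have step_ub3 t : 0 <= t <= rho ->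
    \sum_(i < N.+1) c i * (t <= x_ i.+3)%R%:R <= g t + 3 * eta * D.
  move=> tI; have eta3 : 0 <= 3 * eta by rewrite mulr_ge0// ltW.
  rewrite addrC -lerBlDr (le_trans _ (g_lip t _ eta3))// lerB//
    (le_trans _ (step_ub _))//.
  rewrite ler_sum// => i _; rewrite !x_S lerBlDr.
  by rewrite (_ : x_ i + eta + eta + eta = x_ i + 3 * eta)//; ring.
have [P hP] : exists P : nat -> {poly R}, forall i x, 0 <= x <= rho ->
  [/\ 0 <= (P i).[x], (P i).[x] <= 1, x <= x_ i -> 1 - d <= (P i).[x] &
      x_ i.+1 <= x -> (P i).[x] <= d].
  suff /choice[P hP] : forall i, exists p : {poly R}, forall x, 0 <= x <= rho ->
    [/\ 0 <= p.[x], p.[x] <= 1, x <= x_ i -> 1 - d <= p.[x] &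
      x_ i.+1 <= x -> p.[x] <= d] by exists P.
  by move=> i; apply: step_poly => //; rewrite x_S ltrDl.
have P_lb i x : 0 <= x <= rho -> (x <= x_ i)%R%:R - d <= (P i).[x].
  move=> /(hP i)[h1 h2 h3 h4]; have [xi|xi] := leP x (x_ i); first exact: h3.
  by rewrite sub0r (le_trans _ h1)// oppr_le0 ltW.
have P_ub i x : 0 <= x <= rho -> (P i).[x] <= (x <= x_ i.+1)%R%:R + d.
  move=> /(hP i)[h1 h2 h3 h4]; have [xi|/ltW xi] := leP x (x_ i.+1).
    by rewrite (le_trans h2)// lerDl ltW.
  by rewrite add0r h4.
have LC (L : {scalar {poly R}}) : L 1 <= K -> positive_on L ->
    forall a, 0 <= a -> L a%:P <= a * K.
  move=> LK Lp a a0; rewrite -[a%:P]mulr1 mul_polyC linearZ/=.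
  by rewrite ler_wpM2l.
have le1 : L1 ((rho ^+ n)%:P - 'X^n) <= \sum_(i < N.+1) c i * (L1 (P i.+1) + d * K).
  apply: (@le_trans _ _ (L1 (\sum_(i < N.+1) c i *: (P i.+1 + d%:P)))); last first.
    rewrite linear_sum ler_sum// => i _; rewrite linearZ linearD/=.
    by rewrite ler_wpM2l// lerD2l LC// ltW.
  apply: positive_le => // x xI; rewrite gpoly// (le_trans (step_lb x xI))//.
  rewrite horner_sum ler_sum// => i _; rewrite hornerZ ler_wpM2l// hornerD hornerC.
  by rewrite -lerBlDr P_lb.
(* Both sides are compared with [G (x_ i.+2)]: up to [d], [P i.+1] lies below the indicator at this
   node and [P i.+2] above it. This shift and the width of [P i.+2] account for the three steps in
   [step_ub3]. *)
have le2 i : L1 (P i.+1) + d * K <= L2 (P i.+2) + 3 * d * K.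
  have [h1 _] := c1 _ d0 (x_ i.+2) (P i.+1).
  have [_ h2] := c2 _ d0 (x_ i.+2) (P i.+2).
  have {}h1 := h1 (P_ub i.+1); have {}h2 := h2 (P_lb i.+2).
  lra.
have le3 : \sum_(i < N.+1) c i * L2 (P i.+2) <= L2 ((rho ^+ n)%:P - 'X^n) + (3 *
  eta * D + d * B) * K.
  have w0 : 0 <= 3 * eta * D + d * B.
    have e3 : 0 <= 3 * eta by rewrite pmulr_rge0// ltW.
    exact: addr_ge0 (mulr_ge0 e3 D0) (mulr_ge0 (ltW d0) (ltW B0)).
  apply: (@le_trans _ _ (L2 ((rho ^+ n)%:P - 'X^n + (3 * eta * D + d * B)%:P)));
    last first.
    by rewrite linearD/= lerD2l LC.
  under eq_bigr do rewrite -[_ * _]/(_ *: _) -linearZ.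
  rewrite -linear_sum; apply: positive_le => // x xI.
  rewrite hornerD hornerC gpoly// addrA.
  apply: (@le_trans _ _ (\sum_(i < N.+1) c i * (x <= x_ i.+3)%R%:R + \sum_(i <
    N.+1) c i * d)).
    rewrite horner_sum -big_split/= ler_sum// => i _; rewrite hornerZ -mulrDr.
    by rewrite ler_wpM2l// P_ub.
  by rewrite lerD ?step_ub3// -mulr_suml mulrC ler_wpM2l// ltW.
apply: (le_trans le1).
apply: (@le_trans _ _ (\sum_(i < N.+1) c i * (L2 (P i.+2) + 3 * d * K))).
  by rewrite ler_sum// => i _; rewrite ler_wpM2l.
under eq_bigr do rewrite mulrDr.
rewrite big_split/= -mulr_suml.
have h1 : (\sum_(i < N.+1) c i) * (3 * d * K) <= B * (3 * d * K).
  have d3 : 0 <= 3 * d by rewrite pmulr_rge0// ltW.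
  exact: ler_wpM2r (mulr_ge0 d3 K0) _ _ sumc.
have h2 : 4 * d * B * K <= e / 2.
  rewrite (_ : _ * K = e / 2 * (K / (K + 1))); last first.
    by rewrite /d; field; rewrite !gt_eqF// ltr_pwDr.
  by rewrite ler_piMr ?divr_ge0 ?(ltW e0)// ler_pdivrMr ?ltr_pwDr// mul1r lerDl.
have h3 := lerD le3 h1; apply: (le_trans h3).
rewrite -addrA lerD2l; move: h2 etaE.
rewrite -[4 * d * B * K]mulrA -[_ * D * K]mulrA; lra.
Qed.

Lemma cdf_unique L1 L2 p : L1 1 = K -> L2 1 = K ->
  positive_on L1 -> positive_on L2 -> has_cdf L1 -> has_cdf L2 -> L1 p = L2 p.
Proof.
move=> L1K L2K p1 p2 c1 c2.
have E n : L1 'X^n = L2 'X^n.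
  have C (L : {scalar {poly R}}) : L 1 = K -> L (rho ^+ n)%:P = rho ^+ n * K.
    by move=> <-; rewrite -[_%:P]mulr1 mul_polyC linearZ.
  apply/eqP; rewrite eq_le.
  have := @cdf_le L1 L2 n; have := @cdf_le L2 L1 n;
    rewrite L1K L2K lexx !linearB/= !C//.
  by rewrite !lerD2l !lerN2 => -> // ->.
rewrite -[p]coefK poly_def !linear_sum; apply: eq_bigr => i _.
by rewrite !linearZ/= E.
Qed.

End StieltjesComparison.

(** * The moment problem on a compact interval *)

Section SupportedMeasure.
Context {R : realType}.
Variables (mu : {measure set R -> \bar R}) (rho : R).

Definition supported (mu : {measure set R -> \bar R}) (rho : R) :=
  (mu setT < +oo)%E /\ mu (~` `[0, rho]%classic) = 0%E.

Hypothesis rho0 : 0 < rho.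
Hypothesis smu : supported mu rho.

Lemma measurable_halfline : measurable (@halfline R).
Proof. exact: measurable_itv. Qed.

Lemma supported_fin A : measurable A -> (mu A < +oo)%E.
Proof.
by move=> mA; apply: le_lt_trans smu.1; apply: le_measure; rewrite ?inE.
Qed.

Lemma supported_null A : measurable A -> A `<=` ~` `[0, rho]%classic -> mu A = 0%E.
Proof.
move=> mA sA; apply/eqP; rewrite eq_le measure_ge0 andbT -smu.2.
by apply: le_measure; rewrite ?inE//; apply: measurableC.
Qed.

Lemma supportedI A : measurable A -> mu (A `&` `[0, rho]) = mu A.
Proof.
move=> mA; rewrite -[in RHS](setIT A) -[in RHS](setUv `[0, rho]%classic) setIUr;
  symmetry; apply: measureU0.
- exact: measurableI.
- by apply: measurableI => //; exact: measurableC.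
- by apply: supported_null; [apply: measurableI => //;
  exact: measurableC|move=> x []].
Qed.

Lemma halflineD : @halfline R `\` `]rho, +oo[ = `[0, rho]%classic.
Proof.
apply/seteqP; split=> x; rewrite /halfline/= !in_itv/= !andbT.
  by move=> [-> /negP]; rewrite -leNgt.
by move=> /andP[-> h]; split=> //; apply/negP; rewrite -leNgt.
Qed.

Lemma supported_tail : mu `]rho, +oo[%classic = 0%E.
Proof.
apply: supported_null => // x; rewrite /= !in_itv/= andbT => h.
by apply/negP; rewrite negb_and -!ltNge h orbT.
Qed.

Lemma supported_integrable (f : R -> R) (M : R) : measurable_fun setT f ->
  (forall x, 0 <= x <= rho -> `|f x| <= M) -> mu.-integrable (@halfline R) (EFin
    \o f).
Proof.
move=> mf fM; rewrite (@negligible_integrable _ _ _ mu (@halfline R) `]rho,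
  +oo[%classic)//.
- rewrite halflineD; apply: measurable_bounded_integrable => //.
  + exact: supported_fin.
  + exact: measurable_funTS.
  + exists M; split; first exact: num_real.
    move=> y My x /=; rewrite in_itv/= => xI.
    exact: le_trans (fM _ xI) (ltW My).
- exact: measurable_halfline.
- by apply/measurable_EFinP; exact: measurable_funTS.
- exact: supported_tail.
Qed.

Lemma supported_Rintegral (f : R -> R) : mu.-integrable (@halfline R) (EFin \o f) ->
  (\int[mu]_(x in (@halfline R)) f x)%R = (\int[mu]_(x in `[0%R, rho]) f x)%R.
Proof.
move=> fi; rewrite /Rintegral (@negligible_integral _ _ _ mu (@halfline R)
  `]rho, +oo[%classic)// ?halflineD//.
- exact: measurable_halfline.
- exact: supported_tail.
Qed.

Lemma supported_le (f g : R -> R) : mu.-integrable (@halfline R) (EFin \o f) ->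
  mu.-integrable (@halfline R) (EFin \o g) -> (forall x,
    0 <= x <= rho -> f x <= g x) ->
  (\int[mu]_(x in (@halfline R)) f x)%R <= (\int[mu]_(x in (@halfline R)) g x)%R.
Proof.
move=> fi gi fg; rewrite !supported_Rintegral//.
have sI : `[0, rho] `<=` @halfline R.
  by move=> x; rewrite /halfline/= !in_itv/= andbT => /andP[].
apply: le_Rintegral => //.
- by apply: integrableS fi => //; exact: measurable_halfline.
- by apply: integrableS gi => //; exact: measurable_halfline.
Qed.

Lemma horner_bounded (p : {poly R}) :
  exists M, forall x, 0 <= x <= rho -> `|p.[x]| <= M.
Proof.
exists (\sum_(i < size p) `|p`_i| * rho ^+ i) => x /andP[x0 xr].
rewrite horner_coef (le_trans (ler_norm_sum _ _ _))// ler_sum// => i _.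
rewrite normrM ler_wpM2l// normrX ger0_norm// lerXn2r// nnegrE//.
exact: ltW.
Qed.

Lemma measurable_horner (p : {poly R}) : measurable_fun setT (horner p).
Proof. by apply: continuous_measurable_fun => x; exact: continuous_horner. Qed.

Lemma poly_integrable (p : {poly R}) : mu.-integrable (@halfline R) (EFin \o
  horner p).
Proof.
have [M pM] := horner_bounded p.
exact: supported_integrable (measurable_horner p) pM.
Qed.

Definition polyint (mu : {measure set R -> \bar R}) (p : {poly R}) : R :=
  (\int[mu]_(x in (@halfline R)) p.[x])%R.

Lemma polyint_scalar : scalar (polyint mu).
Proof.
move=> a p q; rewrite /polyint.
under eq_Rintegral do rewrite hornerD hornerZ.
rewrite RintegralD//=; last 2 first.
- have -> : EFin \o (fun x => a * p.[x]) = EFin \o horner (a *: p).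
    by apply/funext => x /=; rewrite hornerZ.
  exact: poly_integrable.
- exact: poly_integrable.
- rewrite RintegralZl//; first exact: measurable_halfline.
  exact: poly_integrable.
- exact: measurable_halfline.
Qed.

Lemma polyintE s : (forall n, polyint mu 'X^n = s n) ->
  forall p, polyint mu p = mom s p.
Proof. by move=> h; apply: mom_unique h; exact: polyint_scalar. Qed.

Lemma Rintegral_indicI A : measurable A ->
  (\int[mu]_(x in (@halfline R)) \1_A x)%R = fine (mu A).
Proof.
move=> mA; rewrite supported_Rintegral; last first.
  apply: (@supported_integrable _ 1) => // x _.
  by rewrite indicE; case: (_ \in _); rewrite ?normr1 ?normr0.
by rewrite /Rintegral integral_indic// supportedI.
Qed.

Lemma polyint1 : polyint mu 1 = fine (mu setT).
Proof.
have -> : polyint mu 1 = (\int[mu]_(x in @halfline R) \1_setT x)%R.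
  by apply: eq_Rintegral => x _; rewrite hornerC indicT.
by rewrite Rintegral_indicI.
Qed.

Lemma polyint_ge0 p : (forall x, 0 <= x <= rho -> 0 <= p.[x]) -> 0 <= polyint mu p.
Proof.
move=> p0; rewrite /polyint supported_Rintegral; last exact: poly_integrable.
by apply: Rintegral_ge0 => x; rewrite /= in_itv => /p0.
Qed.

Definition polyintL : {scalar {poly R}} := HB.pack (polyint mu)
  (GRing.isLinear.Build R {poly R} R *%R (polyint mu) polyint_scalar).

Lemma polyint_has_cdf : has_cdf rho (fine (mu setT))
  (fun y => fine (mu `]-oo, y]%classic)) polyintL.
Proof.
move=> e e0 y p; rewrite -[polyintL p]/(polyint mu p).
have bI : mu.-integrable (@halfline R) (EFin \o \1_(`]-oo, y] : set R)).
  apply: (@supported_integrable _ 1) => // x _.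
  by rewrite indicE; case: (_ \in _); rewrite ?normr1 ?normr0.
have inE' x : \1_(`]-oo, y] : set R) x = (x <= y)%R%:R :> R.
  by rewrite indicE mem_setE in_itv.
have eE : polyint mu e%:P = e * fine (mu setT).
  by rewrite -polyint1 -(scalarZ polyintL) /= -mul_polyC mulr1.
rewrite -(Rintegral_indicI (measurable_itv _)) -eE; split=> hp.
- have iE : mu.-integrable (@halfline R) (EFin \o horner e%:P) := poly_integrable _.
  rewrite /polyint -RintegralD//; last exact: measurable_halfline.
  apply: supported_le => //; first exact: poly_integrable.
    exact: (@integrableD _ _ _ mu _ measurable_halfline _ _ bI iE).
  by move=> x xI; rewrite inE' hornerC; exact: hp.
- have -> : polyint mu p + polyint mu e%:P = polyint mu (p + e%:P).
    by symmetry; exact: (linearD polyintL).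
  apply: supported_le => //; first exact: poly_integrable.
  by move=> x xI; rewrite inE' hornerD hornerC -lerBlDr; exact: hp.
Qed.

End SupportedMeasure.

(** [P] is chosen before [nu], so that it can be used for two measures, or for a whole family of
    them, simultaneously. It converges pointwise on [[0, rho]] to the indicator, at [a] included,
    and dominated convergence applies. *)
Lemma polyint_step_lim (R : realType) (rho a : R) (rho0 : 0 < rho) : exists P :
  nat -> {poly R},
  (forall n x, 0 <= x <= rho -> 0 <= (P n).[x] <= 1) /\
  forall nu, supported nu rho ->
    (fun n => polyint nu (P n)) @ \oo --> fine (nu (`]a, +oo[%classic)).
Proof.
have /choice[Q hQ] : forall n : nat, exists p : {poly R}, forall x, 0 <= x <= rho ->
    [/\ 0 <= p.[x], p.[x] <= 1, x <= a -> 1 - n.+1%:R^-1 <= p.[x] &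
        a + n.+1%:R^-1 <= x -> p.[x] <= n.+1%:R^-1].
  by move=> n; apply: step_poly => //; rewrite ltrDl.
exists (fun n => 1 - Q n); split=> [n x|nu snu].
  by move=> /(hQ n)[q0 q1 _ _]; rewrite hornerD hornerN hornerC subr_ge0 q1 gerBl.
have IE (f : R -> R) : nu.-integrable (@halfline R) (EFin \o f) ->
    (\int[nu]_(x in @halfline R) f x)%R = fine (\int[nu]_(x in `[0%R,
      rho]) (f x)%:E)%E.
  by move=> fi; rewrite (supported_Rintegral snu).
have -> : fine (nu `]a, +oo[%classic) =
    fine (\int[nu]_(x in `[0%R, rho]) (\1_(`]a, +oo[ : set R) x)%:E)%E.
  by rewrite integral_indic// (supportedI snu).
have -> : (fun n => polyint nu (1 - Q n)) =
    (fun n => fine (\int[nu]_(x in `[0%R, rho]) ((1 - Q n).[x])%:E)%E).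
  by apply/funext => n; apply: IE; exact: (poly_integrable rho0 snu).
apply: fine_cvg; rewrite fineK; last first.
  by rewrite integral_indic// ge0_fin_numE// (supported_fin snu)//;
    exact: measurableI.
have [] := @dominated_convergence _ _ _ nu `[0%R, rho]%classic (measurable_itv _)
  (fun n x => ((1 - Q n).[x])%:E) (fun x =>
    (\1_(`]a, +oo[ : set R) x)%:E) (cst 1%E).
- by move=> n; apply/measurable_EFinP/measurable_funTS; exact: measurable_horner.
- by apply/measurable_EFinP/measurable_funTS; exact: measurable_indic.
- apply: aeW => x; rewrite /= in_itv/= => xI; apply: cvg_EFin; first exact: nearW.
  apply/cvgrPdist_le => e e0.
  pose d := if a < x then Num.min e (x - a) else e.
  have d0 : 0 < d by rewrite /d; case: ifP => // ax; rewrite lt_min e0 subr_gt0.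
  have de : d <= e by rewrite /d; case: ifP => //= _; rewrite ge_min lexx.
  have da : a < x -> d <= x - a by move=> ax; rewrite /d ax ge_min lexx orbT.
  have := near_infty_natSinv_lt (PosNum d0); apply: filterS => n /= nd.
  have [q0 q1 qa qb] := hQ n x xI.
  rewrite hornerD hornerN hornerC indicE mem_setE in_itv/= andbT.
  have ne := le_trans (ltW nd) de.
  have [ax|xa] := ltP a x.
    rewrite opprB addrCA subrr addr0 ger0_norm// (le_trans _ ne)// qb//.
    by rewrite -lerBrDl (le_trans (ltW nd))// da.
  rewrite sub0r normrN ger0_norm ?subr_ge0// (le_trans _ ne)//.
  by rewrite lerBlDr -lerBlDl qa.
- have : nu.-integrable `[0, rho] (EFin \o cst 1); last by [].
  apply: measurable_bounded_integrable => //; first exact: (supported_fin snu).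
  by exists 1; split=> // y y1 x _ /=; rewrite normr1 ltW.
- apply: aeW => x n; rewrite /= in_itv/= => xI.
  rewrite lee_fin hornerD hornerN hornerC; have [q0 q1 _ _] := hQ n x xI.
  by rewrite ger0_norm ?subr_ge0// gerBl.
by move=> _ _; apply.
Qed.

Lemma supported_unique (R : realType) (rho : R) (mu nu : {measure set R -> \bar
  R}) :
  0 < rho -> supported mu rho -> supported nu rho ->
  (forall n, polyint mu 'X^n = polyint nu 'X^n) ->
  forall A, measurable A -> mu A = nu A.
Proof.
move=> rho0 smu snu E; have Ep p : polyint mu p = polyint nu p.
  rewrite (polyintE rho0 smu (s := fun n => polyint nu 'X^n))//.
  by rewrite (polyintE rho0 snu (s := fun n => polyint nu 'X^n)).
apply: (@measure_unique _ R _ (@RGenOInfty.G R) (fun k =>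
  `](- k%:R), +oo[%classic)).
- exact: RGenOInfty.measurableE.
- move=> _ _ [x ->] [y ->]; exists (Num.max x y).
  by apply/seteqP; split=> z; rewrite /= !in_itv/= !andbT gt_max => /andP.
- by move=> k; exists (- k%:R).
- apply/seteqP; split=> // x _; exists (Num.truncn `|x|).+1 => //=.
  rewrite in_itv/= andbT ltrNl.
  have /andP[_] := truncn_itv (normr_ge0 x); apply: le_lt_trans.
  by rewrite -normrN ler_norm.
- move=> _ [x ->]; have [P [_ lim]] := polyint_step_lim x rho0.
  have fE : fine (mu `]x, +oo[%classic) = fine (nu `]x, +oo[%classic).
    have := lim _ snu; under eq_fun do rewrite -Ep.
    by have := lim _ smu; exact: (cvg_unique (@Rhausdorff R)).
  rewrite -[LHS]fineK ?ge0_fin_numE ?(supported_fin smu)//.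
  by rewrite -[RHS]fineK ?ge0_fin_numE ?(supported_fin snu)// fE.
- by move=> k; exact: (supported_fin smu).
Qed.

(** * Existence of the representing measure *)

Section MomentProblem.
Context {R : realType}.
Variables (rho : R) (s : nat -> R).
Hypothesis rho0 : 0 < rho.
Hypothesis spos : forall p, (forall x, 0 <= x <= rho -> 0 <= p.[x]) -> 0 <= mom s p.

Let U (y : R) := [set mom s p | p in
  [set p | forall x, 0 <= x <= rho -> (x <= y)%R%:R <= p.[x]]].

(* The distribution function of the measure to be constructed: the upper value of
   the functional on the indicator of ]-oo, y]. *)
Let G y := inf (U y).

Let U_ge0 y : lbound (U y) 0.
Proof.
by move=> _ [p hp <-]; apply: spos => x xI; apply: le_trans (hp x xI);
  rewrite ler0n.
Qed.

Let U1 y : U y (mom s 1).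
Proof. by exists 1 => // x _; rewrite hornerC lern1 leq_b1. Qed.

Let U_inf y : has_inf (U y).
Proof. by split; [exists (mom s 1)|exists 0]. Qed.

Let G_le y p : (forall x, 0 <= x <= rho -> (x <= y)%R%:R <= p.[x]) -> G y <= mom
  s p.
Proof. by move=> hp; apply: ge_inf; [exact: (U_inf y).2|exists p]. Qed.

Let G_ge y m : (forall p, (forall x, 0 <= x <= rho -> (x <= y)%R%:R <= p.[x]) ->
  m <= mom s p) -> m <= G y.
Proof.
by move=> hm; apply: lb_le_inf; [exists (mom s 1)|move=> _ [p hp <-]; exact: hm].
Qed.

Let mom_le p q : (forall x, 0 <= x <= rho -> p.[x] <= q.[x]) -> mom s p <= mom s q.
Proof. exact: (@positive_le _ rho (mom s)). Qed.

Let momC a : mom s a%:P = a * mom s 1.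
Proof. by rewrite -(scalarZ (mom s)) -mul_polyC mulr1. Qed.

Let K := mom s 1.

Let K0 : 0 <= K.
Proof. by apply: spos => x _; rewrite hornerC. Qed.

Let G_has_cdf : has_cdf rho K G (mom s).
Proof.
move=> e e0 y p; split=> hp.
- rewrite -lerBlDr; apply: G_ge => q hq; rewrite lerBlDr -momC -linearD/=.
  apply: mom_le => x xI; rewrite hornerD hornerC (le_trans (hp x xI))//.
  by rewrite lerD2r hq.
- rewrite -momC -linearD/=; apply: G_le => x xI.
  by rewrite hornerD hornerC -lerBlDr hp.
Qed.

Let G_neg y : y < 0 -> G y = 0.
Proof.
move=> y0; apply/eqP; rewrite eq_le; apply/andP; split.
  rewrite -(linear0 (mom s)); apply: G_le => x /andP[x0 _].
  have -> : (x <= y) = false by apply/negbTE; rewrite -ltNge (lt_le_trans y0).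
  by rewrite horner0.
by apply: G_ge => p hp; apply: (@U_ge0 y); exists p.
Qed.

Let G_rho : G rho = K.
Proof.
apply/eqP; rewrite eq_le; apply/andP; split.
  by apply: G_le => x _; rewrite hornerC lern1 leq_b1.
apply: G_ge => p hp; apply: mom_le => x xI; rewrite hornerC.
by apply: le_trans (hp x xI); case/andP: xI => _ ->.
Qed.

Let G_nd : {homo G : x y / x <= y}.
Proof.
move=> x y xy; apply: G_ge => p hp; apply: G_le => z zI.
apply: le_trans (hp z zI); have [zx|//] := leP z x.
by rewrite (le_trans zx xy).
Qed.

(** A polynomial [p] nearly optimal for [y] is at least 1 at [y], hence at least [1 - d] slightly to
    the right, so [p + d%:P] competes for [G x]. The total loss is d + d K = e. *)
Let G_rc : right_continuous G.
Proof.
move=> y; apply/cvgrPdist_le => e e0.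
pose d := e / (1 + K).
have K1 : 0 < 1 + K by rewrite ltr_pwDl.
have d0 : 0 < d by rewrite divr_gt0.
have [_ [p hp <-] pG] := inf_adherent d0 (U_inf y).
have near_p : \forall x \near y^'+, forall z,
  y < z <= x -> 0 <= z <= rho -> 1 - d <= p.[z].
  have [y0|y0] := ltP y 0.
    near=> x => z /andP[_ zx] /andP[z0 _].
    have : x < 0 by near: x; exact: nbhs_right_lt.
    by rewrite ltNge (le_trans z0 zx).
  have [yr|yr] := ltP rho y.
    near=> x => z /andP[yz _] /andP[_ zr].
    by have := lt_trans (le_lt_trans zr yr) yz; rewrite ltxx.
  have py : 1 <= p.[y] by have := hp y; rewrite lexx; apply; rewrite y0.
  have /cvgrPdist_le/(_ _ d0)[r /= r0 hr] := @continuous_horner _ p y.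
  near=> x => z /andP[yz zx] _.
  have : `|p.[y] - p.[z]| <= d.
    apply: hr; rewrite /= distrC gtr0_norm ?subr_gt0//.
    rewrite ltrBlDr (le_lt_trans zx)//.
    by near: x; apply: nbhs_right_lt; rewrite ltrDr.
  by move/ler_normlW; rewrite lerBlDr => h; rewrite lerBlDr (le_trans py)// addrC.
near=> x.
have yx : y < x by near: x; exact: nbhs_right_gt.
rewrite ler0_norm ?subr_le0 ?G_nd ?(ltW yx)// opprB lerBlDr.
apply: (@le_trans _ _ (mom s (p + d%:P))).
  apply: G_le => z zI; rewrite hornerD hornerC.
  have [zx|zx] := leP z x; last first.
    by rewrite addr_ge0 ?(ltW d0)// (le_trans _ (hp z zI)).
  have [zy|yz] := leP z y.
    by have := hp z zI; rewrite zy => /le_trans; apply; rewrite lerDl ltW.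
  rewrite -lerBlDr; have := near near_p x; apply => //.
  by rewrite yz.
rewrite linearD/= momC (le_trans (lerD (ltW pG) (lexx _)))//.
rewrite -addrA addrC lerD2r -/K.
by rewrite (_ : d + d * K = e) // /d; field; rewrite gt_eqF.
Unshelve. all: by end_near. Qed.

Let Gc : cumulative R R := HB.pack G (isCumulative.Build R _ R G G_nd G_rc).

Let lsf (A : set R) : \bar R := lebesgue_stieltjes_measure Gc A.

Let lsf0 : lsf set0 = 0%E.
Proof. exact: (measure0 (lebesgue_stieltjes_measure Gc)). Qed.

Let lsf_ge0 A : (0 <= lsf A)%E.
Proof. exact: (measure_ge0 (lebesgue_stieltjes_measure Gc)). Qed.

Let lsf_sigma_additive : semi_sigma_additive lsf.
Proof.
exact: (@measure_semi_sigma_additive _ _ _ (lebesgue_stieltjes_measure Gc)).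
Qed.

Let ls : {measure set R -> \bar R} := HB.pack lsf
  (isMeasure.Build _ R R lsf lsf0 lsf_ge0 lsf_sigma_additive).

Let lsE a b : a <= b -> ls `]a, b]%classic = (G b - G a)%:E.
Proof.
move=> ab; rewrite /ls/= /lsf /lebesgue_stieltjes_measure /measure_extension.
rewrite measurable_mu_extE/=; last exact: is_ocitv.
by rewrite wlength_itv_bnd.
Qed.

(** [lsE] only measures half-open intervals, and [G] may jump at 0. The mass of [[0, m]], atom at 0
    included, is that of []-1, m]] once the open interval is known to be null. *)
Let ls_neg : ls `]-1, 0[%classic = 0%E.
Proof.
suff : ls.-negligible `]-1, 0[%classic.
  by move/measure_negligible; apply; exact: measurable_itv.
apply: (@negligibleS _ _ _ ls (\bigcup_n `]-1, - n.+1%:R^-1]%classic)).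
  move=> x; rewrite /= in_itv/= => /andP[x1 x0].
  have x0' : 0 < - x by rewrite oppr_gt0.
  have [n _ /(_ n (leqnn n)) /= hn] := near_infty_natSinv_lt (PosNum x0').
  by exists n => //=; rewrite in_itv/= x1 lerNr ltW.
apply: negligible_bigcup => n; apply/negligibleP => //.
have n0 : - n.+1%:R^-1 < 0 :> R by rewrite oppr_lt0.
have n1 : -1 <= - n.+1%:R^-1 :> R by rewrite lerN2 invf_le1// ler1n.
by apply: (etrans (lsE n1)); rewrite !G_neg// ?subrr// ltrN10.
Qed.

Let ls_pos m : 0 <= m -> ls `[0, m]%classic = (G m)%:E.
Proof.
move=> m0; have -> : (G m)%:E = ls `]-1, m]%classic.
  have n1 : -1 <= m by rewrite (le_trans _ m0)// lerN10.
  by apply/esym/(etrans (lsE n1)); rewrite [G (-1)]G_neg ?subr0// ltrN10.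
have -> : `]-1, m]%classic = `[0, m]%classic `|` `]-1, 0[%classic :> set R.
  apply/seteqP; split=> x /=; rewrite !in_itv/=.
    by move=> /andP[h1 ->]; have [x0|x0] := leP 0 x; [left|right; rewrite h1].
  move=> [/andP[x0 ->]|/andP[-> x0]]; last by rewrite (le_trans (ltW x0)).
  by rewrite (lt_le_trans _ x0)// ltrN10.
by symmetry; apply: measureU0.
Qed.

Let mI : measurable (`[0, rho] : set R).
Proof. exact: measurable_itv. Qed.

(** The restriction of [ls] to [[0, rho]] has distribution function [G], and [mom s] satisfies
    [has_cdf] for the same [G]; [cdf_unique] then identifies the two functionals. *)
Lemma moment_measure : exists mu : {measure set R -> \bar R},
  supported mu rho /\ forall p, polyint mu p = mom s p.
Proof.
pose mu : {measure set R -> \bar R} := mrestr ls mI.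
have muI A : mu A = ls (A `&` `[0, rho]) by [].
have muE y : mu `]-oo, y]%classic = (G y)%:E.
  rewrite muI; have [y0|y0] := ltP y 0.
    rewrite (_ : _ `&` _ = set0) ?measure0 ?G_neg//.
    apply/seteqP; split=> // x [] /=; rewrite !in_itv/= => xy /andP[x0 _].
    by have := le_lt_trans (le_trans x0 xy) y0; rewrite ltxx.
  rewrite (_ : _ `&` _ = `[0, Num.min y rho]%classic); last first.
    apply/seteqP; split=> x /=; rewrite !in_itv/= le_min.
      by move=> [-> /andP[-> ->]].
    by move=> /and3P[-> -> ->].
  rewrite ls_pos ?le_min ?y0 ?(ltW rho0)//; congr EFin.
  have [//|ry] := leP y rho; apply/eqP; rewrite eq_le (G_nd (ltW ry)) G_rho.
  by apply: G_le => x _; rewrite hornerC lern1 leq_b1.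
have muTE : mu setT = K%:E.
  by rewrite muI setTI ls_pos ?G_rho// ltW.
have smu : supported mu rho.
  split; last by rewrite muI setICl measure0.
  by rewrite muTE ltry.
exists mu; split=> // p.
have muT : fine (mu setT) = K by rewrite muTE.
apply: (@cdf_unique _ rho K G rho0 (polyintL rho0 smu) (mom s)) => //.
- by rewrite -muT -(polyint1 smu).
- exact: (polyint_ge0 rho0 smu).
- have := polyint_has_cdf rho0 smu; rewrite muT.
  rewrite (_ : (fun y : R => _) = G)//.
  by apply/funext => y; rewrite muE.
Qed.

End MomentProblem.

(** * Semispectral measures *)

Section Semispectral.
Context {R : realType} {H : hilbertType R}.
Implicit Types (F : semispectral H) (h : H).

Definition qmeas F h : {measure set R -> \bar R} := qmeasure F h.

Lemma qmeasE F h D : borel_halfline D -> qmeas F h D = (qf (F D) h)%:E.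
Proof.
move=> [mD sD]; rewrite -[qmeas F h D]/(qmeasure F h D) qmeasureE//.
by rewrite (_ : D `&` _ = D)//; exact/setIidl.
Qed.

Lemma qmeasI F h D : qmeas F h (D `&` @halfline R) = qmeas F h D.
Proof. rewrite -[LHS]/(qmeasure F h (D `&` _)) -[RHS]/(qmeasure F h D).
by rewrite /qmeasure -setIA setIid. Qed.

Lemma borel_halflineT : borel_halfline (@halfline R).
Proof. by split=> //; exact: measurable_halfline. Qed.

Lemma smeas_eq0 F D : borel_halfline D -> (F D = 0) <-> (forall h,
  qmeas F h D = 0%E).
Proof.
move=> bD; split=> [FD0 h|qm0]; first by rewrite qmeasE// FD0 qf0.
apply: qf_inj; [exact: smeas_ge0|exact: bop_ge00|move=> h].
by have := qm0 h; rewrite qmeasE// qf0 => -[].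
Qed.

Lemma smeas_set0 F : F set0 = 0.
Proof. by apply/smeas_eq0 => [|h]; [split|rewrite measure0]. Qed.

Lemma qmeas_fin F h D : measurable D -> (qmeas F h D < +oo)%E.
Proof.
by move=> mD; rewrite -qmeasI qmeasE ?ltry//; exact: borel_halflineI.
Qed.

Lemma setC_itv_halfline (r : R) : 0 <= r ->
  ~` `[0, r]%classic `&` @halfline R = `]r, +oo[%classic.
Proof.
move=> r0; apply/seteqP; split=> x; rewrite /halfline/= !in_itv/= !andbT.
  by move=> [/negP + x0]; rewrite x0/= -ltNge.
by move=> rx; split; [apply/negP; rewrite negb_and -!ltNge rx orbT|exact: ltW
  (le_lt_trans r0 rx)].
Qed.

Lemma borel_tail (r : R) : 0 <= r -> borel_halfline `]r, +oo[%classic.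
Proof.
move=> r0; split; first exact: measurable_itv.
by move=> x; rewrite /halfline/= !in_itv/= !andbT => /(le_lt_trans r0)/ltW.
Qed.

Lemma supported_qmeasP F (r : R) : 0 <= r ->
  (forall h, supported (qmeas F h) r) <-> F `]r, +oo[%classic = 0.
Proof.
move=> r0; rewrite smeas_eq0; last exact: borel_tail.
have E h : qmeas F h (~` `[0, r]%classic) = qmeas F h `]r, +oo[%classic.
  by rewrite -qmeasI setC_itv_halfline.
split=> [s h|s h]; first by have [_] := s h; rewrite E.
by split; [exact: qmeas_fin|rewrite E].
Qed.

Lemma compactly_supportedW F (r : R) : 0 <= r -> F `]r, +oo[%classic = 0 ->
  compactly_supported F.
Proof.
move=> r0 Fr; have cI : closed (`[0, r] : set R) by exact: itv_closed.
have hI : @halfline R `\` `[0, r]%classic = `]r, +oo[%classic :> set R.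
  by rewrite setDE setIC setC_itv_halfline.
apply: (subclosed_compact _ (@segment_compact R 0 r)).
  by apply: closed_bigI => K [].
apply: bigcap_inf; split=> //; last by rewrite hI.
by move=> x; rewrite /halfline/= !in_itv/= andbT => /andP[].
Qed.

(** [closed_support] intersects possibly uncountably many closed sets, so nullity of its complement
    requires a countable cover: for fixed [h], each point of the tail lies in a rational interval
    that is null for [qmeas F h]. *)
Lemma compactly_supported_tail F : compactly_supported F ->
  exists2 r, 0 < r & F `]r, +oo[%classic = 0.
Proof.
move=> /compact_bounded [M [_ Mb]].
have [r r0 rb] : exists2 r, 0 < r & closed_support F `<=` [set x | x <= r].
  exists (Num.max 1 (M + 1)); first by rewrite lt_max ltr01.
  move=> x Sx; rewrite /= le_max; apply/orP; right.
  by rewrite (le_trans (ler_norm x))// (Mb (M + 1))// ltrDl.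
exists r => //; apply/smeas_eq0 => [|h]; first exact/borel_tail/ltW.
pose I (pq : rat * rat) : set R := `]ratr pq.1, ratr pq.2[%classic.
(* An enumeration of the null rational intervals, with [set0] for the other codes. *)
pose V n : set R := oapp (fun pq => if `[< qmeas F h (I pq) = 0%E >] then I pq
  else set0)
  set0 (@unpickle (rat * rat)%type n).
suff : (qmeas F h).-negligible `]r, +oo[%classic.
  by move/measure_negligible; apply; exact: measurable_itv.
apply: (@negligibleS _ _ _ (qmeas F h) (\bigcup_n V n)); last first.
  apply: negligible_bigcup => n; rewrite /V.
  case: (unpickle n) => [pq|]/=; last exact: negligible_set0.
  case: asboolP => [qm0|_]; last exact: negligible_set0.
  by apply/negligibleP => //; exact: measurable_itv.
move=> x; rewrite /= in_itv/= andbT => rx.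
have x0 : 0 < x by exact: lt_trans rx.
have [K [cK sK FK] nKx] : exists2 K, [/\ closed K, K `<=` @halfline R &
    F (@halfline R `\` K) = 0] & ~ K x.
  apply: contrapT => h1; have : closed_support F x.
    by move=> K FK; apply: contrapT => nKx; apply: h1; exists K.
  by move/rb => /=; rewrite leNgt rx.
have oK : open (~` K) by exact: closed_openC.
have [d /= d0 dK] : nbhs_ball x (~` K) by apply/nbhs_ballP/open_nbhs_nbhs.
have xd1 : x - d < x by rewrite ltrBlDr ltrDl.
have xd2 : x < x + d by rewrite ltrDl.
have [p] := rat_in_itvoo xd1; have [q] := rat_in_itvoo xd2.
rewrite !in_itv/= => /andP[xq qx] /andP[px pq].
have [n nE] : exists n, @unpickle (rat * rat)%type n = Some (p, q).
  by exists (@pickle (rat * rat)%type (p, q)); rewrite pickleK.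
exists n; first exact: Logic.I.
rewrite /V nE [oapp _ _ _]/=.
rewrite asboolT; first by rewrite /I/= in_itv/= pq xq.
apply/eqP; rewrite eq_le measure_ge0 andbT.
have bK : borel_halfline (@halfline R `\` K).
  split; last exact: subDsetl.
  by apply: measurableD; [exact: measurable_halfline|exact: closed_measurable].
have /(_ h) <- := (smeas_eq0 F bK).1 FK.
rewrite -(qmeasI F h (I (p, q))).
apply: le_measure.
- by apply/mem_set; apply: (@measurableI _ R);
  [exact: measurable_itv|exact: measurable_halfline].
- by apply/mem_set; case: bK.
- move=> y []; rewrite {1}/I/= in_itv/= => /andP[py yq] hy; split=> //.
  apply: dK; rewrite -ball_normE/= ltr_norml ltrBrDr ltrBlDr.
  by move: px qx; rewrite ltrBlDr => px qx; rewrite addrC; apply/andP; split; lra.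
Qed.

Lemma supported_le_max F (r r' : R) : 0 <= r -> r <= r' ->
  (forall h, supported (qmeas F h) r) -> forall h, supported (qmeas F h) r'.
Proof.
move=> r0 rr' sF h; split; first exact: qmeas_fin.
apply: (supported_null (sF h)); first exact: measurableC.
apply: subsetC => x; rewrite /= !in_itv/= => /andP[-> xr]/=.
exact: le_trans rr'.
Qed.

Lemma supported_max F G : compactly_supported F -> compactly_supported G ->
  exists r, [/\ 0 < r, forall h, supported (qmeas F h) r & forall h,
    supported (qmeas G h) r].
Proof.
move=> /compactly_supported_tail[a a0 Fa] /compactly_supported_tail[b b0 Gb].
have sF := (supported_qmeasP F (ltW a0)).2 Fa.
have sG := (supported_qmeasP G (ltW b0)).2 Gb.
exists (Num.max a b); split; first by rewrite lt_max a0.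
- by apply: (supported_le_max (ltW a0)) sF; rewrite le_max lexx.
- by apply: (supported_le_max (ltW b0)) sG; rewrite le_max lexx orbT.
Qed.

(** Partial sums of the [N (D k)] are positive operators, so by [weak_cvg] weak sigma-additivity is
    that of the scalar measures [mu h]. *)
Lemma semispectral_of (N : set R -> bop H) (mu : H -> {measure set R -> \bar R}) :
  (forall D, borel_halfline D -> bop_ge0 (N D)) ->
  (forall h D, borel_halfline D -> mu h D = (qf (N D) h)%:E) ->
  exists F : semispectral H, forall D, F D = N D.
Proof.
move=> N0 muN.
have sa : forall D : nat -> set R, (forall k, borel_halfline (D k)) ->
    trivIset setT D -> forall g h : H,
    (fun n => \sum_(0 <= k < n) '[N (D k) g, h] : R[i]^o) @ \oo -->
      ('[N (\bigcup_k D k) g, h] : R[i]^o).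
  move=> D bD tD g h.
  have bU : borel_halfline (\bigcup_k D k).
    split; first by apply: bigcupT_measurable => k; case: (bD k).
    by move=> x [k _]; case: (bD k) => _; apply.
  have -> : (fun n => \sum_(0 <= k < n) '[N (D k) g, h]) =
      (fun n => '[(\sum_(0 <= k < n) N (D k)) g, h]).
    apply/funext => n; elim: n => [|n IH].
      by rewrite !big_geq//= (linear0l inner).
    by rewrite !big_nat_recr//= innerDl IH.
  apply: (@weak_cvg R H (fun n => \sum_(0 <= k < n) N (D k)) (N (\bigcup_k D k))).
  - by move=> n; apply: bop_ge0_sum => k _; exact: N0.
  - exact: N0.
  - move=> {}h; have mD k : measurable (D k) by case: (bD k).
    have := @measure_semi_sigma_additive _ _ _ (mu h) D mD tD bU.1.
    rewrite muN//; under eq_fun do under eq_bigr do rewrite muN//.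
    under eq_fun do rewrite sumEFin.
    by under [X in _ -> X @ _ --> _]eq_fun do rewrite qf_sum; move/fine_cvg.
by exists (Semispectral N0 sa).
Qed.

Lemma integral_step (mu : {measure set R -> \bar R}) (r c : R) (B : nat -> set
  R) n :
  supported mu r -> (forall i, measurable (B i)) ->
  mu.-integrable (@halfline R) (EFin \o (fun x => \sum_(i < n) c * \1_(B i) x)) /\
  (\int[mu]_(x in @halfline R) (\sum_(i < n) c * \1_(B i) x))%R =
    \sum_(i < n) c * fine (mu (B i)).
Proof.
move=> smu mB; have mhl := @measurable_halfline R.
have iB i : mu.-integrable (@halfline R) (EFin \o (\1_(B i) : R -> R)).
  apply: (@supported_integrable _ _ r smu _ 1) => // x _.
  by rewrite indicE; case: (_ \in _); rewrite ?normr1 ?normr0.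
elim: n => [|n [IH1 IH2]].
  split.
    apply: (@eq_integrable _ _ _ mu _ mhl (cst 0%E)); last exact: integrable0.
    by move=> x _ /=; rewrite big_ord0.
  under eq_Rintegral do rewrite big_ord0.
  by rewrite Rintegral_cst// mul0r big_ord0.
have icB : mu.-integrable (@halfline R) (EFin \o (fun x => c * \1_(B n) x)).
  exact: integrableZl (iB n).
split.
  apply: (@eq_integrable _ _ _ mu _ mhl
    ((EFin \o (fun x => \sum_(i < n) c * \1_(B i) x)) \+
     (EFin \o (fun x => c * \1_(B n) x)))); last exact: integrableD.
  by move=> x _ /=; rewrite big_ord_recr.
under eq_Rintegral do rewrite big_ord_recr/=.
rewrite RintegralD// IH2 RintegralZl// (Rintegral_indicI smu)//.
by rewrite [in RHS]big_ord_recr.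
Qed.

(* z is approximated by c times the number of multiples of c below it. *)
Lemma layer_cake (z c : R) (n : nat) : 0 <= c -> 0 <= z <= n.+1%:R * c ->
  z - c <= \sum_(i < n.+1) c * (i.+1%:R * c <= z)%R%:R <= z.
Proof.
move=> c0 /andP[z0 zM].
pose f (i : nat) := Num.min z (i%:R * c).
have tel (k : nat) : \sum_(i < n.+1) (f (i.+1 + k)%N - f (i + k)%N) = f (n.+1 +
  k)%N - f k.
  rewrite -(big_mkord xpredT (fun i => f (i.+1 + k)%N - f (i + k)%N)).
  by rewrite (telescope_sumr (fun i => f (i + k)%N)).
have step (i : nat) : i.+1%:R * c = i%:R * c + c by rewrite -natr1 mulrDl mul1r.
have fM : f n.+1 = z by rewrite /f min_l.
have f0 : f 0%N = 0 by rewrite /f mul0r min_r.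
apply/andP; split.
- apply: (@le_trans _ _ (f (n.+1 + 1)%N - f 1%N)).
    rewrite lerB//; last by rewrite /f mul1r ge_min lexx orbT.
    by rewrite addn1 /f le_min lexx step (le_trans zM)// lerDl.
  rewrite -tel ler_sum// => i _; rewrite !addn1 /f.
  have [h|h] := leP (i.+1%:R * c) z.
    by rewrite mulr1 lerBlDr addrC -step ge_min lexx orbT.
  by rewrite mulr0 subr_le0 ge_min lexx.
- apply: (@le_trans _ _ (\sum_(i < n.+1) (f (i.+1 + 0)%N - f (i + 0)%N)));
  last first.
    by rewrite tel addn0 fM f0 subr0.
  rewrite ler_sum// => i _; rewrite !addn0 /f.
  have [h|h] := leP (i.+1%:R * c) z.
    by rewrite mulr1 lerBrDr step addrC lerD2r ge_min lexx orbT.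
  by rewrite mulr0 subr_ge0 ge_min lexx.
Qed.

(* The name sintegral of Defs is shadowed by that of the integral of simple functions. *)
Lemma sintegralE F (z : R -> R) (A : bop H) : is_sintegral F z A ->
  Defs.sintegral F z = A.
Proof.
move=> FA; have FB : is_sintegral F z (Defs.sintegral F z) by exact: (xgetPex 0
  (ex_intro _ A FA)).
by apply: quad_inj => h; rewrite (FA h).2 (FB h).2.
Qed.

(** [A n] is the integral of a layer-cake sum, a nonnegative combination of values of [F] on
    superlevel sets of [z]. Its form differs from the integral of [z] by at most [c n * m h], and
    [bop_lim] provides the operator. *)
Lemma sintegralP F (r : R) (z : R -> R) (M : R) :
  (forall h, supported (qmeas F h) r) -> measurable_fun setT z ->
  (forall x, 0 <= x <= r -> 0 <= z x <= M) -> 0 <= M ->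
  is_sintegral F z (Defs.sintegral F z).
Proof.
move=> sF mz zM M0.
have iz h : (qmeas F h).-integrable (@halfline R) (EFin \o z).
  apply: (@supported_integrable _ _ r (sF h) _ M) => // x /zM/andP[z0 zle].
  by rewrite ger0_norm.
suff [A A0 AE] : exists2 A, bop_ge0 A & forall h,
    qf A h = (\int[qmeas F h]_(x in @halfline R) z x)%R.
  have FA : is_sintegral F z A.
    by move=> h; split; [exact: iz|rewrite (bop_ge0E A0) AE].
  by rewrite (sintegralE FA).
pose c n : R := M / n.+1%:R.
have c0 n : 0 <= c n by rewrite divr_ge0.
have zc n x : 0 <= x <= r -> 0 <= z x <= n.+1%:R * c n.
  by move=> /zM; rewrite /c mulrC divfK.
pose B n (i : nat) := z @^-1` `[i.+1%:R * c n, +oo[%classic.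
have mB n i : measurable (B n i).
  by rewrite -[B n i]setTI; apply: mz => //; exact: measurable_itv.
have bB n i : borel_halfline (B n i `&` @halfline R) by exact: borel_halflineI.
pose A n : bop H := \sum_(i < n.+1) (c n)%:C *: F (B n i `&` @halfline R).
have A0 n : bop_ge0 (A n).
  by apply: bop_ge0_sum => i _; apply: bop_ge0Z => //; exact: smeas_ge0.
have AE n h : qf (A n) h =
    (\int[qmeas F h]_(x in @halfline R) (\sum_(i < n.+1) c n * \1_(B n i) x))%R.
  rewrite (integral_step _ _ (sF h) (mB n)).2 qf_sum; apply: eq_bigr => i _.
  by rewrite qfZ -(qmeasI F h (B n i)) qmeasE.
have BE n i x : \1_(B n i) x = (i.+1%:R * c n <= z x)%R%:R :> R.
  rewrite indicE; congr (nat_of_bool _)%:R.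
  by apply/idP/idP; rewrite inE /B/= in_itv/= andbT.
have Aub n h : qf (A n) h <= (\int[qmeas F h]_(x in @halfline R) z x)%R.
  rewrite AE; apply: (supported_le (sF h)) => //.
    exact: (integral_step _ _ (sF h) (mB n)).1.
  move=> x xI; under eq_bigr do rewrite BE.
  by have /andP[] := layer_cake (c0 n) (zc n x xI).
pose m h := fine (qmeas F h setT).
have Alb n h : (\int[qmeas F h]_(x in @halfline R) z x)%R - c n * m h <= qf (A n) h.
  have icst : (qmeas F h).-integrable (@halfline R) (EFin \o (fun=> c n)).
    apply: (@supported_integrable _ _ r (sF h) _ (c n)) => // x _.
    by rewrite ger0_norm.
  have mT : fine (qmeas F h (@halfline R)) = m h.
    by rewrite /m -[in RHS](qmeasI F h setT) setTI.
  rewrite -mT -Rintegral_cst; last exact: measurable_halfline.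
  rewrite -RintegralB//; last exact: measurable_halfline.
  rewrite AE; apply: (supported_le (sF h)) => //.
  - apply: (@supported_integrable _ _ r (sF h) _ (M + c n)) =>
    [|x /zM/andP[z0 zle]].
      by apply: measurable_funB => //; exact: measurable_cst.
    by rewrite (le_trans (ler_normB _ _))// !ger0_norm// lerD2r.
  - exact: (integral_step _ _ (sF h) (mB n)).1.
  move=> x xI; under eq_bigr do rewrite BE.
  by have /andP[] := layer_cake (c0 n) (zc n x xI).
have [K K0 KF] := qf_bounded (F (@halfline R)).
apply: (@bop_lim _ _ A (M * K)) => //; first exact: mulr_ge0.
- move=> n h; apply: (le_trans (Aub n h)).
  apply: (@le_trans _ _ (\int[qmeas F h]_(x in @halfline R) M)%R).
    apply: (supported_le (sF h)) => //; last by move=> x /zM/andP[].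
    apply: (@supported_integrable _ _ r (sF h) _ M) => // x _.
    by rewrite ger0_norm.
  rewrite Rintegral_cst; last exact: measurable_halfline.
  rewrite -mulrA ler_wpM2l// qmeasE; last exact: borel_halflineT.
  exact: KF.
- move=> h; apply/cvgrPdist_le => e e0.
  have mh0 : 0 <= m h by rewrite fine_ge0.
  have d0 : 0 < e / (M * m h + 1) by rewrite divr_gt0// ltr_wpDl// mulr_ge0.
  have := near_infty_natSinv_lt (PosNum d0); apply: filterS => n /= nd.
  rewrite ger0_norm ?subr_ge0// lerBlDr -lerBlDl.
  apply: le_trans (Alb n h); rewrite lerB// /c.
  move: nd; rewrite ltr_pdivlMr ?ltr_wpDl ?mulr_ge0// => /ltW nd.
  apply: le_trans nd; rewrite mulrAC mulrC ler_wpM2l// lerDl//.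
Qed.

End Semispectral.

(** * Second differences *)

Section SecondDifference.
Context {R : realType}.
Implicit Types (u : nat -> R) (p q : {poly R}).

Definition diff2 u n : R := u n - u n.+1 *+ 2 + u n.+2.

Lemma mom_diff2 u q : mom u (q * ('X - 1) ^+ 2) = mom (diff2 u) q.
Proof.
have -> : q * ('X - 1) ^+ 2 = q * 'X^0 - (q * 'X^1) *+ 2 + q * 'X^2.
  by rewrite expr0 expr1 !exprS expr0; ring.
rewrite linearD linearB linearMn/= !momMXn /mom /diff2.
rewrite -sumrMnl -sumrB -big_split/=; apply: eq_bigr => i _.
by rewrite addn0 addn1 addn2 mulrDr mulrBr mulrnAr.
Qed.

Lemma diff2_inj u v : u 0%N = v 0%N -> u 1%N = v 1%N ->
  (forall n, diff2 u n = diff2 v n) -> u =1 v.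
Proof.
move=> e0 e1 e2; suff h n : u n = v n /\ u n.+1 = v n.+1 by move=> n; case: (h n).
elim: n => [//|n [h0 h1]]; split=> //; have := e2 n.
by rewrite /diff2 h0 h1 => /addrI.
Qed.

(** Truncated subtraction covers the vanishing coefficients with [j >= n.-1] as well. *)
Lemma coef_Qpoly n j : (Qpoly R n)`_j = (n - j - 1)%:R.
Proof.
rewrite /Qpoly big_mkord coef_sum.
under eq_bigr do rewrite coefZ coefXn.
have [jn|nj] := ltnP j n.-1.
  rewrite (bigD1 (Ordinal jn))//= eqxx mulr1 big1 ?addr0// => i ij.
  by rewrite eq_sym -[j]/(val (Ordinal jn)) (inj_eq val_inj) (negbTE ij) mulr0.
rewrite (_ : (n - j - 1 = 0)%N); last by lia.
by rewrite big1// => i _; rewrite gtn_eqF ?mulr0// (leq_trans (ltn_ord i)).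
Qed.

(** With [Qpoly_small] this characterizes [Qpoly]: it is the double sum of the powers of X with zero
    initial values. *)
Lemma diff2_Qpoly n :
  Qpoly R n - Qpoly R n.+1 *+ 2 + Qpoly R n.+2 = 'X^n.
Proof.
apply/polyP => j; rewrite !(coefD, coefN, coefMn) !coef_Qpoly coefXn.
have [jn|nj] := ltnP j n.
  have [k ->] : exists k, n = (j + k.+1)%N by exists (n - j).-1; lia.
  rewrite (_ : (j + k.+1 - j - 1 = k)%N); last by lia.
  rewrite (_ : ((j + k.+1).+1 - j - 1 = k.+1)%N); last by lia.
  rewrite (_ : ((j + k.+1).+2 - j - 1 = k.+2)%N); last by lia.
  rewrite (_ : (j == _)%N = false); last by lia.
  by rewrite -[k.+2]addn2 -[k.+1]addn1 !natrD mulr0n; ring.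
rewrite (_ : (n - j - 1 = 0)%N); last by lia.
rewrite (_ : (n.+1 - j - 1 = 0)%N); last by lia.
rewrite (_ : (n.+2 - j - 1 = (j == n))%N); last by lia.
by rewrite ?(mulr0n, mul0rn, subr0, add0r, oppr0).
Qed.

Lemma diff2_repr (L : {scalar {poly R}}) (a b c : R) n :
  diff2 (fun m => a + b *+ m + c *+ (m ^ 2) + L (Qpoly R m)) n = c *+ 2 + L 'X^n.
Proof.
rewrite -(diff2_Qpoly n) linearD linearB linearMn/= /diff2.
rewrite -![c *+ (_ ^ 2)]mulr_natr -![b *+ _]mulr_natr !natrX.
ring.
Qed.

Lemma Qpoly_small n : (n <= 1)%N -> Qpoly R n = 0.
Proof. by move=> n1; apply/polyP => j;
  rewrite coef_Qpoly coef0 (_ : n - j - 1 = 0)%N//; lia. Qed.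

Lemma Qpoly_ge0 n (x : R) : 0 <= x -> 0 <= (Qpoly R n).[x].
Proof.
by move=> x0; rewrite horner_coef sumr_ge0// => i _;
  rewrite coef_Qpoly mulr_ge0 ?exprn_ge0.
Qed.

Lemma mom_sqr u n (a : nat -> R) : mom u ((\sum_(i < n) a i *: 'X^i) ^+ 2) =
  \sum_(i < n) \sum_(j < n) u (i + j)%N * a i * a j.
Proof.
rewrite expr2 mulr_suml linear_sum; apply: eq_bigr => i _.
rewrite mulr_sumr linear_sum; apply: eq_bigr => j _.
rewrite -scalerAl -scalerAr scalerA -exprD linearZ/= mom_Xn.
by rewrite mulrC mulrA.
Qed.

(* A polynomial whose coefficients sum to 0 is a multiple of X - 1, and
   multiplication by (X - 1) ^ 2 turns u into its second difference. *)
Lemma cpd_seqP u : cpd_seq u <-> forall q, 0 <= mom (diff2 u) (q ^+ 2).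
Proof.
split=> [cu q|pos k lambda sl].
- rewrite -mom_diff2 -exprMn; set p := q * _.
  (* A zero coefficient is appended because [cpd_seq] ranges over ['I_k.+1]. *)
  have pE : p = \sum_(i < (size p).+1) p`_i *: 'X^i.
    by rewrite big_ord_recr/= nth_default// scale0r addr0 -poly_def coefK.
  have p1 : \sum_(i < (size p).+1) p`_i = 0.
    have : p.[1] = 0 by rewrite /p !hornerE subrr mulr0.
    rewrite [p in p.[1]]pE horner_sum => e0; rewrite -[RHS]e0;
      apply: eq_bigr => i _.
    by rewrite hornerZ hornerXn expr1n mulr1.
  have := cu (size p) (fun i => (p`_i)%:C); rewrite -rmorph_sum/= p1 => /(_ erefl).
  rewrite [in mom _ _]pE (mom_sqr _ _ (fun i => p`_i)) -lecR rmorph_sum/=.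
  congr (0 <= _); apply: eq_bigr => i _; rewrite rmorph_sum/=.
  by apply: eq_bigr => j _; rewrite conjC_realc !rmorphM.
(* Real and imaginary parts of the coefficients each sum to 0, and the mixed terms cancel by
   symmetry of the Hankel form [S]. *)
- pose a (i : nat) := complex.Re (lambda (inord i)).
  pose b (i : nat) := complex.Im (lambda (inord i)).
  have lE i : lambda i = (a i)%:C + 'i%R * (b i)%:C.
    by rewrite /a /b inord_val [LHS]complexE complexiE.
  have sa : \sum_(i < k.+1) a i = 0.
    have /(congr1 (@complex.Re R)) := sl.
    by rewrite raddf_sum/= => e0; rewrite -[RHS]e0; apply: eq_bigr => i _;
      rewrite /a inord_val.
  have sb : \sum_(i < k.+1) b i = 0.
    have /(congr1 (@complex.Im R)) := sl.
    by rewrite raddf_sum/= => e0; rewrite -[RHS]e0; apply: eq_bigr => i _;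
      rewrite /b inord_val.
  have psqr (c : nat -> R) : \sum_(i < k.+1) c i = 0 ->
      0 <= \sum_(i < k.+1) \sum_(j < k.+1) u (i + j)%N * c i * c j.
    move=> sc; rewrite -mom_sqr; set p := \sum_(i < _) _.
    have /factor_theorem[q ->] : root p 1.
      apply/eqP; rewrite /p horner_sum -[RHS]sc; apply: eq_bigr => i _.
      by rewrite hornerZ hornerXn expr1n mulr1.
    by rewrite exprMn mom_diff2.
  pose S (c d : nat -> R) := \sum_(i < k.+1) \sum_(j < k.+1) u (i + j)%N * c i *
    d j.
  have SC : S a b = S b a.
    rewrite /S exchange_big; apply: eq_bigr => i _; apply: eq_bigr => j _.
    by rewrite addnC mulrAC.
  have -> : \sum_(i < k.+1) \sum_(j < k.+1)
      (u (i + j)%N)%:C * lambda i * conjC (lambda j) = (S a a + S b b)%:C.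
    transitivity ((S a a)%:C + (S b b)%:C + 'i%R * ((S b a)%:C - (S a b)%:C) :
      R[i]); last first.
      by rewrite SC subrr mulr0 addr0 rmorphD.
    rewrite /S !rmorph_sum/= -!sumrB mulr_sumr -!big_split/=; apply: eq_bigr => i _.
    rewrite !rmorph_sum/= -!sumrB mulr_sumr -!big_split/=; apply: eq_bigr => j _.
    rewrite !lE rmorphD rmorphM/= conjCi !conjC_realc !rmorphM/=.
    have := sqrCi R[i]; set I := 'i%R => I2.
    set x := (u _)%:C; set a1 := (a i)%:C; set a2 := (a j)%:C.
    set b1 := (b i)%:C; set b2 := (b j)%:C.
    transitivity (x * a1 * a2 - I ^+ 2 * (x * b1 * b2) + I * (x * b1 * a2 - x *
      a1 * b2)).
      by ring.
    by rewrite I2 mulN1r opprK.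
  by rewrite lecR addr_ge0 ?psqr.
Qed.

End SecondDifference.

(** Monomials are nonnegative on the half-line, where the integral is additive in the measure;
    linearity yields all polynomials. *)
Lemma polyint_add_dirac (R : realType) (mu nu : {measure set R -> \bar R}) (r c
  : R) :
  0 < r -> supported mu r -> supported nu r -> 0 <= c ->
  (forall D, borel_halfline D -> mu D = (nu D + c%:E * \d_(1%R : R) D)%E) ->
  forall p, polyint mu p = polyint nu p + c * p.[1].
Proof.
move=> r0 smu snu c0 muE.
have EX n : polyint mu 'X^n = polyint nu 'X^n + c.
  have X0 x : @halfline R x -> (0 <= ('X^n : {poly R}).[x]%:E)%E.
    by rewrite /halfline/= in_itv/= andbT hornerXn lee_fin => x0; rewrite exprn_ge0.
  have mX D : measurable_fun D (fun x : R => ('X^n : {poly R}).[x]%:E).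
    by apply/measurable_EFinP/measurable_funTS; exact: measurable_horner.
  have mhl := @measurable_halfline R.
  have h1 : @halfline R 1 by rewrite /halfline/= in_itv/= andbT.
  rewrite /polyint /Rintegral.
  rewrite (eq_measure_integral (measure_add nu (mscale (NngNum c0) (\d_(1 :
    R))))); last first.
    by move=> D mD sD; rewrite muE//; exact/esym/measure_addE.
  rewrite ge0_integral_measure_add// ge0_integral_mscale// integral_dirac//.
  rewrite diracE mem_set// mul1e hornerXn expr1n mule1 fineD//.
  have := poly_integrable r0 snu 'X^n => /integrable_fin_num; apply.
  exact: measurable_halfline.
move=> p; rewrite (polyintE r0 smu EX) (polyintE r0 snu (s := fun n =>
  polyint nu 'X^n))//.
rewrite /mom horner_coef mulr_sumr -big_split/=; apply: eq_bigr => i _.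
by rewrite expr1n mulr1 mulrDr [c * _]mulrC.
Qed.

(** * The three representations *)

Section Representations.
Context {R : realType} {H : hilbertType R}.
Variable T : bop H.
Implicit Types (F M : semispectral H) (h : H).

Definition orbit_nrm2 h n : R := nrm ((T ^+ n) h) ^+ 2.

Lemma inner_expr n x y : '[(T ^+ n) x, y] = '[x, (adj T ^+ n) y].
Proof.
elim: n x y => [//|n IH] x y.
by rewrite exprS exprSr -[(T * _) x]/(T (_ x)) adjP IH.
Qed.

Lemma inner_adjX_exprn n h : '[(adj T ^+ n * T ^+ n) h, h] = (orbit_nrm2 h n)%:C.
Proof.
have -> : (adj T ^+ n * T ^+ n) h = (adj T ^+ n) ((T ^+ n) h) by [].
rewrite innerC -inner_expr inner_nrm.
by rewrite conjC_realc.
Qed.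

Definition diffop n : bop H :=
  adj T ^+ n * (1 - (adj T * T) *+ 2 + adj T ^+ 2 * T ^+ 2) * T ^+ n.

Lemma diffopE n : diffop n = adj T ^+ n * T ^+ n
  - (adj T ^+ n.+1 * T ^+ n.+1) *+ 2 + adj T ^+ n.+2 * T ^+ n.+2.
Proof.
rewrite /diffop mulrDr mulrBr mulr1 !mulrDl mulNr mulrnAr mulrnAl.
rewrite -[in n.+2](addn2 n) exprD -[(n + 2)%N]addnC exprD !mulrA.
by rewrite -exprSr -[in LHS]mulrA -exprS.
Qed.

Lemma inner_diffop n h : '[diffop n h, h] = (diff2 (orbit_nrm2 h) n)%:C.
Proof.
rewrite diffopE /diff2.
transitivity ('[(adj T ^+ n * T ^+ n) h, h]
  - '[(adj T ^+ n.+1 * T ^+ n.+1) h, h] *+ 2 + '[(adj T ^+ n.+2 * T ^+ n.+2) h, h]).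
  by rewrite mulr2n /= !innerDl innerNl innerDl mulr2n.
by rewrite !inner_adjX_exprn rmorphD rmorphB rmorphMn.
Qed.

Lemma cpdE : cpd T <-> forall h q, 0 <= mom (diff2 (orbit_nrm2 h)) (q ^+ 2).
Proof.
by split=> [cT h|cT h]; [apply: (cpd_seqP _).1; exact: cT|apply: (cpd_seqP _).2;
  exact: cT].
Qed.

(** The integral exists by [sintegralP], so the operator identities in (ii) and (iii) become scalar
    identities for each [h]. *)
Lemma sintegral_polyP F (r : R) (p : {poly R}) (A : bop H) : 0 < r ->
  (forall h, supported (qmeas F h) r) -> (forall x, 0 <= x <= r -> 0 <= p.[x]) ->
  A = Defs.sintegral F (horner p) <->
  forall h, '[A h, h] = (polyint (qmeas F h) p)%:C.
Proof.
move=> r0 sF p0; have [M pM] := horner_bounded r0 p.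
have FP : is_sintegral F (horner p) (Defs.sintegral F (horner p)).
  apply: (@sintegralP _ _ F r _ (Num.max 0 M)) => //.
  - exact: measurable_horner.
  - move=> x xI; rewrite p0//= le_max; apply/orP; right.
    exact: le_trans (ler_norm _) (pM x xI).
  - by rewrite le_max lexx.
split=> [-> h|AE]; first exact: (FP h).2.
apply/esym/sintegralE => h; split; first exact: (FP h).1.
exact: AE.
Qed.

Lemma cpd_measureP M (r : R) : 0 < r -> (forall h, supported (qmeas M h) r) ->
  cpd_measure T M <-> forall h n, polyint (qmeas M h) 'X^n = diff2 (orbit_nrm2 h) n.
Proof.
move=> r0 sM; have cM : compactly_supported M.
  by apply: (compactly_supportedW (ltW r0)); apply/(supported_qmeasP M (ltW r0)).
have XE n : (fun x : R => x ^+ n) = horner 'X^n.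
  by apply/funext => x; rewrite hornerXn.
have X0 n x : 0 <= x <= r -> 0 <= ('X^n : {poly R}).[x].
  by move=> /andP[x0 _]; rewrite hornerXn exprn_ge0.
split=> [[_ E] h n|E].
  have := E n; rewrite XE -/(diffop n) => /(sintegral_polyP _ r0 sM (X0 n))/(_ h).
  by rewrite inner_diffop => /complexI.
split=> // n; rewrite XE -/(diffop n); apply/(sintegral_polyP _ r0 sM (X0 n)) => h.
by rewrite inner_diffop E.
Qed.

Lemma mom_of_measure M (r : R) : 0 < r -> (forall h, supported (qmeas M h) r) ->
  cpd_measure T M -> forall h p, polyint (qmeas M h) p = mom (diff2 (orbit_nrm2
    h)) p.
Proof.
by move=> r0 sM /(cpd_measureP r0 sM) E h; apply: (polyintE r0 (sM h)); exact: E.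
Qed.

Lemma cpd_of_measure M : cpd_measure T M -> cpd T.
Proof.
move=> cM; have [r [r0 sM _]] := supported_max cM.1 cM.1.
apply/cpdE => h q; rewrite -(mom_of_measure r0 sM cM).
by apply: (polyint_ge0 r0 (sM h)) => x _; rewrite horner_exp sqr_ge0.
Qed.

Lemma cpd_measure_unique M M' : cpd_measure T M -> cpd_measure T M' ->
  eq_semispectral M M'.
Proof.
move=> cM cM'; have [r [r0 sM sM']] := supported_max cM.1 cM'.1.
move=> D bD; apply: qf_inj; [exact: smeas_ge0|exact: smeas_ge0|move=> h].
have : qmeas M h D = qmeas M' h D.
  apply: (supported_unique r0 (sM h) (sM' h)) bD.1 => n.
  by rewrite !(mom_of_measure r0).
by rewrite !qmeasE// => -[].
Qed.

Lemma orbit_nrm2_shift h n : orbit_nrm2 h n.+1 = orbit_nrm2 (T h) n.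
Proof. by rewrite /orbit_nrm2 [T ^+ n.+1]exprSr. Qed.

(** Only [C] depends on [h]: a common [rho] puts all the measures on one interval and makes the
    support of M compact. *)
Lemma diff2_orbit_growth : exists2 rho, 0 < rho &
  forall h, exists C, forall n, `|diff2 (orbit_nrm2 h) n| <= C * rho ^+ n.
Proof.
have [K0 [K0_ge0 TK]] := bop_bounded T.
have KE : K0 = (complex.Re K0)%:C by rewrite RRe_real// ger0_real.
(* The summand 1 keeps [rho = K ^+ 2] positive when the bound of [T] is 0. *)
pose K := complex.Re K0 + 1.
have K1 : 1 <= K by rewrite lerDr -lecR -KE.
have TK' h : nrm (T h) <= K * nrm h.
  rewrite -lecR rmorphM/= -!nrmE (le_trans (TK h))// KE ler_wpM2r// lecR.
  by rewrite lerDl.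
pose rho := K ^+ 2; have rho1 : 1 <= rho by rewrite exprn_ege1.
have rho0 : 0 < rho by exact: lt_le_trans rho1.
have gS h n : orbit_nrm2 h n.+1 <= rho * orbit_nrm2 h n.
  have K0' : 0 <= K by exact: le_trans K1.
  rewrite /orbit_nrm2 [T ^+ n.+1]exprS -exprMn lerXn2r ?nnegrE ?nrm_ge0//.
  - by rewrite mulr_ge0 ?nrm_ge0.
  - exact: TK'.
have g0 h n : 0 <= orbit_nrm2 h n by exact: sqr_ge0.
exists rho => // h; exists ((1 + rho *+ 2 + rho ^+ 2) * orbit_nrm2 h 0) => n.
have gn : orbit_nrm2 h n <= rho ^+ n * orbit_nrm2 h 0.
  elim: n => [|n IH]; first by rewrite mul1r.
  by rewrite (le_trans (gS h n))// exprS -mulrA ler_wpM2l// ltW.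
have r0 := ltW rho0.
have c0 : 0 <= 1 + rho *+ 2 + rho ^+ 2.
  by apply: addr_ge0 (exprn_ge0 _ r0); apply: addr_ge0 => //; exact: mulrn_wge0.
apply: (@le_trans _ _ ((1 + rho *+ 2 + rho ^+ 2) * orbit_nrm2 h n)); last first.
  by rewrite -mulrA [orbit_nrm2 h 0 * _]mulrC ler_wpM2l.
have h1 := gS h n; have h2 := gS h n.+1.
have h3 : orbit_nrm2 h n.+2 <= rho ^+ 2 * orbit_nrm2 h n.
  by rewrite (le_trans h2)// expr2 -mulrA ler_wpM2l// ltW.
rewrite /diff2 (le_trans (ler_normD _ _))//
  (le_trans (lerD (ler_normB _ _) (lexx _)))//.
rewrite normrMn !ger0_norm//.
rewrite [leRHS](_ : _ = orbit_nrm2 h n + (rho * orbit_nrm2 h n) *+ 2 + rho ^+ 2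
  * orbit_nrm2 h n); last by ring.
by rewrite !lerD// lerMn2r h1 orbT.
Qed.

(* The Borel sets D on which h |-> mu_h (D) is the quadratic form of an operator form a
   Dynkin class, by bop_lim for countable unions; it contains the half-lines
   because these are limits of polynomials, for which the operator is explicit. *)
Lemma measure_of_cpd : cpd T -> exists M, cpd_measure T M.
Proof.
move=> /cpdE cT; have [rho rho0 growth] := diff2_orbit_growth.
pose s h := diff2 (orbit_nrm2 h).
have spos h p : (forall x, 0 <= x <= rho -> 0 <= p.[x]) -> 0 <= mom (s h) p.
  have [C hC] := growth h.
  apply: (@mom_ge0_itv _ (s h) C rho rho0 (cT h) _ hC p) => q.
  rewrite -['X]expr1 momMXn; rewrite (eq_mom (s' := s (T h))); first exact: cT.
  by move=> n; rewrite /s /diff2 addn1 !orbit_nrm2_shift.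
have /choice[mu hmu] : forall h, exists mu : {measure set R -> \bar R},
    supported mu rho /\ forall p, polyint mu p = mom (s h) p.
  by move=> h; exact: (moment_measure rho0 (spos h)).
have smu h := (hmu h).1; have Emu h := (hmu h).2.
(* [opp p] is the future integral of [p] against M; [opp 1] is the total mass, whose bound [K] is
   the uniform bound demanded by [bop_lim]. *)
pose opp (p : {poly R}) : bop H := \sum_(i < size p) (p`_i)%:C *: diffop i.
have oppE p h : '[opp p h, h] = (mom (s h) p)%:C.
  rewrite /opp /mom rmorph_sum/=; elim/big_rec2: _ => [|i y1 y2 _ IH].
    by rewrite /= (linear0l inner).
  by rewrite /= innerDl innerZl inner_diffop IH rmorphM.
have qf_opp p h : qf (opp p) h = mom (s h) p by rewrite /qf oppE.
have opp0 p : (forall x, 0 <= x <= rho -> 0 <= p.[x]) -> bop_ge0 (opp p).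
  by move=> p0 h; rewrite oppE lecR spos.
have opp1 : bop_ge0 (opp 1) by apply: opp0 => x _; rewrite hornerC.
have muT h : fine (mu h setT) = qf (opp 1) h by rewrite qf_opp -Emu (polyint1
  (smu h)).
have [K K0 hK] := qf_bounded (opp 1).
have fin h D : measurable D -> mu h D \is a fin_num.
  by move=> mD; rewrite ge0_fin_numE// (supported_fin (smu h)).
have dyn D : measurable D ->
    exists2 A : bop H, bop_ge0 A & forall h, qf A h = fine (mu h D).
  move=> mD.
  apply: (@dynkin_induction _ R (@RGenOInfty.G R)
    [set D | exists2 A : bop H, bop_ge0 A & forall h, qf A h = fine (mu h D)]).
  - exact: RGenOInfty.measurableE.
  - move=> _ _ [x ->] [y ->]; exists (Num.max x y).
    by apply/seteqP; split=> z; rewrite /= !in_itv/= !andbT gt_max => /andP.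
  - by exists (opp 1).
  - move=> _ [a ->]; have [P [P01 Plim]] := polyint_step_lim a rho0.
    apply: (@bop_lim _ _ (fun n => opp (P n)) K) => //.
    + by move=> n; apply: opp0 => x /(P01 n)/andP[].
    + move=> n h; apply: le_trans (hK h); rewrite !qf_opp -subr_ge0 -linearB.
      by apply: spos => x /(P01 n)/andP[_ p1];
        rewrite hornerD hornerN hornerC subr_ge0.
    + move=> h; have := Plim _ (smu h).
      by rewrite (_ : (fun n => _) = (fun n => qf (opp (P n)) h))//;
        apply/funext => n; rewrite qf_opp Emu.
  - move=> S mS [A A0 AE].
    have CE h : qf (opp 1 - A) h = fine (mu h (~` S)).
      have mC := measurableC mS.
      have -> : mu h (~` S) = (mu h setT - mu h S)%E.
        by rewrite -setTD measureD ?setTI// ltey_eq fin.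
      by rewrite fineB ?fin// qfD qfN AE muT.
    exists (opp 1 - A) => // h.
    have hA : '[(opp 1 - A) h, h] = '[opp 1 h, h] - '[A h,
      h] by rewrite /= innerDl innerNl.
    rewrite hA (bop_ge0E opp1) (bop_ge0E A0) -rmorphB lecR.
    by have := CE h; rewrite qfD qfN => ->; rewrite fine_ge0.
  - move=> F mF tF hF.
    have /choice[A hA] : forall n, exists A : bop H, bop_ge0 A /\
        forall h, qf A h = fine (mu h (F n)).
      by move=> n; have [A] := hF n; exists A.
    have mU : measurable (\bigcup_k F k) by exact: bigcupT_measurable.
    have SE h : (fun n => qf (\sum_(0 <= k < n) A k) h) @ \oo --> fine (mu h
      (\bigcup_k F k)).
      have := @measure_semi_sigma_additive _ _ _ (mu h) F mF tF mU.
      rewrite -[mu h (\bigcup_k F k)]fineK ?fin// => /fine_cvg.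
      rewrite (_ : fine \o _ = (fun n => qf (\sum_(0 <= k < n) A k) h))//.
      apply/funext => n /=; rewrite qf_sum -sum_fine; last by move=> k _;
        exact: fin.
      by apply: eq_bigr => k _; rewrite (hA k).2.
    apply: (@bop_lim _ _ (fun n => \sum_(0 <= k < n) A k) K) => //.
    + by move=> n; apply: bop_ge0_sum => k _; exact: (hA k).1.
    + move=> n h; apply: le_trans (hK h); rewrite -muT.
      apply: (@le_trans _ _ (fine (mu h (\bigcup_k F k)))); last first.
        by rewrite fine_le ?fin//; apply: le_measure; rewrite ?inE.
      rewrite -(cvg_lim (@Rhausdorff R) (SE h)).
      apply: nondecreasing_cvgn_le; last exact: cvgP (SE h).
      apply/nondecreasing_seqP => m; rewrite big_nat_recr//= qfD lerDl.
      exact: qf_ge0 (hA m).1 h.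
  - exact: (eq_ind _ (fun S => S D) mD _ (RGenOInfty.measurableE R)).
(* The specification is conditional on [D], so that choice can range over all sets, with 0 at the
   non-Borel ones. *)
have /choice[N hN] : forall D, exists A : bop H, borel_halfline D ->
    bop_ge0 A /\ forall h, mu h D = (qf A h)%:E.
  move=> D; have [bD|nbD] := pselect (borel_halfline D); last by exists 0.
  have [A A0 AE] := dyn D bD.1; exists A => _; split=> // h.
  by rewrite AE fineK// fin//; case: bD.
have [M MN] := @semispectral_of _ _ N mu (fun D bD => (hN D bD).1)
  (fun h D bD => (hN D bD).2 h).
have qmM h D : borel_halfline D -> qmeas M h D = mu h D.
  by move=> bD; rewrite qmeasE// MN (hN D bD).2.
have sM h : supported (qmeas M h) rho.
  move: h; apply/(supported_qmeasP M (ltW rho0)).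
  have bt := borel_tail (ltW rho0); apply/(smeas_eq0 M bt) => h.
  by rewrite qmM// (supported_tail (smu h)).
exists M; apply/(cpd_measureP rho0 sM) => h n.
rewrite -/(s h n) -(mom_Xn (s h)) -Emu /polyint /Rintegral; congr fine.
by apply: eq_measure_integral => D mD sD; apply: qmM.
Qed.

(** The operator-valued point mass of weight [A] at 1. *)
Definition at1 (A : bop H) (D : set R) : bop H := if (1 : R) \in D then A else 0.

Lemma at1E (A : bop H) D h : (qf (at1 A D) h)%:E = ((qf A h)%:E * \d_(1%R : R) D)%E.
Proof. by rewrite /at1 diracE; case: (_ \in _); rewrite ?mule1 ?mule0 ?qf0. Qed.

Lemma at1_ge0 (A : bop H) D : bop_ge0 A -> bop_ge0 (at1 A D).
Proof. by rewrite /at1; case: ifP => // _ _; exact: bop_ge00. Qed.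

Lemma borel_set1 : borel_halfline [set 1 : R].
Proof. by split=> // x /= ->; rewrite /halfline/= in_itv/= ler01. Qed.

(* The moments of M = F + 2 C delta_1 are the second differences of the
   right-hand side of (ii), because those of n ^ 2 are all equal to 2. *)
Lemma measure_of_triplet B C F : cpd_triplet T B C F ->
  exists2 M, cpd_measure T M & forall D,
    borel_halfline D -> M D = F D + at1 (C *+ 2) D.
Proof.
move=> [_ C0 cF _ E].
have [r [r0 sF _]] := supported_max cF cF.
have C20 : bop_ge0 (C *+ 2) by rewrite mulr2n; exact: bop_ge0D.
pose N D := F D + at1 (C *+ 2) D.
have N0 D : borel_halfline D -> bop_ge0 (N D).
  by move=> bD; apply: bop_ge0D; [exact: smeas_ge0|exact: at1_ge0].
pose c h := NngNum (qf_ge0 C20 h).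
pose mu h : {measure set R -> \bar R} := measure_add (qmeas F h) (mscale (c h)
  (\d_(1 : R))).
have muE h D : mu h D = (qmeas F h D + (qf (C *+ 2) h)%:E * \d_(1%R : R) D)%E.
  exact: measure_addE.
have muN h D : borel_halfline D -> mu h D = (qf (N D) h)%:E.
  by move=> bD; rewrite muE qmeasE// [qf (N D) h]qfD EFinD at1E.
have [M MN] := semispectral_of N0 muN.
exists M => //.
(* The interval is enlarged to contain the atom at 1. *)
pose r' := Num.max r 1.
have r'0 : 0 < r' by rewrite lt_max r0.
have sF' := supported_le_max (ltW r0) (_ : r <= r') sF.
have {}sF' : forall h, supported (qmeas F h) r' by apply: sF'; rewrite le_max lexx.
have sM : forall h, supported (qmeas M h) r'.
  apply/(supported_qmeasP M (ltW r'0)); rewrite MN /N.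
  have -> : F `]r', +oo[%classic = 0 by apply/(supported_qmeasP F (ltW r'0)).
  rewrite add0r /at1 ifF//; apply/negbTE; rewrite notin_setE/= in_itv/= andbT.
  by apply/negP; rewrite -leNgt le_max lexx orbT.
apply/(cpd_measureP r'0 sM) => h n.
rewrite (@polyint_add_dirac _ _ (qmeas F h) r' (qf (C *+ 2) h))//; last first.
- by move=> D bD; rewrite qmeasE// MN// [qf (N D) h]qfD EFinD at1E qmeasE.
- exact: qf_ge0.
have gE m : orbit_nrm2 h m = nrm h ^+ 2 + qf B h *+ m + qf C h *+ (m ^ 2) +
    polyint (qmeas F h) (Qpoly R m).
  have Qx x : 0 <= x <= r' -> 0 <= (Qpoly R m).[x].
    by move=> /andP[x0 _]; exact: Qpoly_ge0.
  have /(_ h) QE := (sintegral_polyP (Defs.sintegral F (horner (Qpoly R m))) r'0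
    sF' Qx).1 erefl.
  have -> : orbit_nrm2 h m = qf (adj T ^+ m * T ^+ m) h by rewrite /qf
    inner_adjX_exprn.
  by rewrite E !qfD !qfMn qf1; congr (_ + _); rewrite /qf QE.
have -> : diff2 (orbit_nrm2 h) n = diff2 (fun m => nrm h ^+ 2 + qf B h *+ m +
    qf C h *+ (m ^ 2) + polyintL r'0 (sF' h) (Qpoly R m)) n.
  by rewrite /diff2 !gE.
by rewrite diff2_repr hornerXn expr1n mulr1 qfMn addrC.
Qed.

Lemma inner_herm (B : bop H) : adj B = B -> forall h, '[B h, h] = (qf B h)%:C.
Proof.
move=> aB h; have /(congr1 (@complex.Im R)) : '[B h, h] = conjC '[B h, h].
  by rewrite {1}adjP aB {1}innerC.
rewrite conjcE /qf; case: '[B h, h] => a b /= /eqP.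
by rewrite -subr_eq0 opprK -mulr2n mulrn_eq0/= => /eqP ->.
Qed.

(** Both sides of (ii) have the same second differences, so by [diff2_inj] only n = 0 and n = 1
    remain. The integral vanishes there, and n = 1 dictates B = T*T - I - C. *)
Lemma triplet_of_measure M : cpd_measure T M -> exists2 F,
  cpd_triplet T (adj T * T - 1 - (2^-1 : R[i]) *: M [set 1]) ((2^-1 : R[i]) *: M
    [set 1]) F &
  forall D, borel_halfline D -> F D = M (D `\` [set 1]).
Proof.
move=> cM; have [r [r0 sM _]] := supported_max cM.1 cM.1.
set M1 := M [set 1].
have M10 : bop_ge0 M1 by apply: smeas_ge0; exact: borel_set1.
have halfC : (2^-1 : R[i]) = (2^-1)%:C by rewrite fmorphV rmorph_nat.
pose N D := M (D `\` [set 1]).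
have bN (D : set R) : borel_halfline D -> borel_halfline (D `\` [set 1]).
  by move=> [mD sD]; split; [exact: measurableD|exact: subset_trans (@subDsetl _
    _ _) sD].
have N0 D : borel_halfline D -> bop_ge0 (N D).
  by move=> bD; apply: smeas_ge0; exact: bN.
have mC1 : measurable (~` [set 1 : R]) by exact: measurableC.
pose mu h : {measure set R -> \bar R} := mrestr (qmeas M h) mC1.
have muN h D : borel_halfline D -> mu h D = (qf (N D) h)%:E.
  by move=> bD; rewrite -qmeasE ?setDE//; exact: bN.
have [F FN] := semispectral_of N0 muN.
have sF : forall h, supported (qmeas F h) r.
  apply/(supported_qmeasP F (ltW r0)); have bt := borel_tail (ltW r0).
  rewrite FN /N; apply/(smeas_eq0 M (bN _ bt)) => h.
  apply: (supported_null (sM h)); first by case: (bN _ bt).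
  by move=> x [] /=; rewrite !in_itv/= andbT => rx _; apply/negP;
    rewrite negb_and -!ltNge rx orbT.
have cF : compactly_supported F.
  by apply: (compactly_supportedW (ltW r0)); apply/(supported_qmeasP F (ltW r0)).
set C := _ *: M1; set B := _ - C.
have C0 : bop_ge0 C by rewrite /C halfC; apply: bop_ge0Z => //; rewrite invr_ge0.
have aT x y : '[(adj T * T) x, y] = '[x, (adj T * T) y].
  have E z : (adj T * T) z = adj T (T z) by [].
  by rewrite !E [LHS]innerC -adjP -innerC adjP.
have aB : adj B = B.
  apply: adj_unique => x y.
  have BE g k : '[B g, k] = '[(adj T * T) g, k] - '[g, k] - '[C g, k].
    by rewrite /B /= !innerDl !innerNl.
  by rewrite [RHS]innerC !BE !rmorphB/= -(bop_ge0_herm C0) -!innerC aT.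
have qfC h : qf C h = qf M1 h / 2 by rewrite /C halfC qfZ mulrC.
have qfB h : qf B h = orbit_nrm2 h 1 - orbit_nrm2 h 0 - qf M1 h / 2.
  rewrite !qfD !qfN qfC qf1; congr (_ - _ - _).
  by have := inner_adjX_exprn 1 h; rewrite !expr1 /qf => ->.
exists F => //; split=> //.
  by rewrite FN /N setDv smeas_set0.
move=> n; apply: quad_inj => h.
have Qx m x : 0 <= x <= r -> 0 <= (Qpoly R m).[x].
  by move=> /andP[x0 _]; exact: Qpoly_ge0.
have QE m := (sintegral_polyP (Defs.sintegral F (horner (Qpoly R m))) r0 sF (@Qx
  m)).1 erefl h.
set L := polyint (qmeas F h).
have MFE p : polyint (qmeas M h) p = L p + qf M1 h * p.[1].
  apply: (polyint_add_dirac r0 (sM h) (sF h)); first exact: qf_ge0.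
  move=> D bD; rewrite [qmeas F h D]qmeasE//
    FN /N -(qmeasE _ _ (bN D bD)) -(qmeasE _ _ borel_set1).
  rewrite diracE; have [|nD] := boolP ((1 : R) \in D).
    rewrite inE => D1; rewrite mule1 -measureU//.
    - by congr (qmeas M h _); rewrite setUC setDUK// => x /= ->.
    - by case: (bN D bD).
    - by apply/seteqP; split=> // x [[_ nx] /nx].
  rewrite mule0 adde0 setDE; congr (qmeas M h _); apply/esym/setIidl => x Dx /= x1.
  by move: nD; rewrite -x1 mem_set.
have gE : orbit_nrm2 h =1 (fun n => nrm h ^+ 2 + qf B h *+ n + qf C h *+ (n ^ 2)
  + L (Qpoly R n)).
  have L0 : L 0 = 0 := linear0 (polyintL r0 (sF h)).
  apply: diff2_inj.
  - by rewrite Qpoly_small// mulr0n/= mulr0n !addr0 L0 addr0.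
  - rewrite Qpoly_small// mulr1n/= mulr1n L0 addr0 qfB qfC.
    by rewrite /orbit_nrm2 expr0/=; ring.
  - move=> m; rewrite (diff2_repr (polyintL r0 (sF h))) -((cpd_measureP r0 sM).1
    cM).
    by rewrite MFE hornerXn expr1n mulr1 qfC addrC mulr2n -splitr.
rewrite inner_adjX_exprn gE.
transitivity ('[(1 : bop H) h, h] + '[B h, h] *+ n + '[C h, h] *+ (n ^ 2) +
    '[Defs.sintegral F (horner (Qpoly R n)) h, h]).
  by rewrite QE inner_nrm (inner_herm aB) (bop_ge0E C0) -!rmorphMn -!rmorphD.
have MnE (A : bop H) k : '[A h, h] *+ k = '[(A *+ k) h, h].
  elim: k => [|k IH]; first by rewrite /= (linear0l inner).
  by rewrite !mulrS IH /= innerDl.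
by rewrite !MnE /= !innerDl.
Qed.

(** By uniqueness [M] is the measure F + 2 C delta_1 built from the triplet. As F has no mass at 1,
    evaluation at {1} gives C and removal of 1 gives F; the case n = 1 of (ii) gives B. *)
Lemma cpd_formulas B C F M : cpd_triplet T B C F -> cpd_measure T M ->
  [/\ B = adj T * T - 1 - (2^-1 : R[i]) *: M [set 1],
      C = (2^-1 : R[i]) *: M [set 1] &
      forall D : set R, borel_halfline D -> F D = M (D `\` [set 1])].
Proof.
move=> tF cM; have [M' cM' M'E] := measure_of_triplet tF.
have ME := cpd_measure_unique cM cM'.
have [_ _ cF F1 E] := tF.
have CE : C = (2^-1 : R[i]) *: M [set 1].
  rewrite ME ?M'E; [|exact: borel_set1..]; rewrite F1 add0r /at1 mem_set//.
  have -> : C *+ 2 = (2 : R[i]) *: C by rewrite scaler_nat.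
  by rewrite scalerA mulVf ?pnatr_eq0// scale1r.
split=> //.
  have [r [r0 sF _]] := supported_max cF cF.
  have Q1 : (0 : bop H) = Defs.sintegral F (horner (Qpoly R 1)).
    rewrite Qpoly_small//; apply/(sintegral_polyP _ r0 sF) => [x _|h].
      by rewrite horner0.
    have P0 : polyint (qmeas F h) 0 = 0 := linear0 (polyintL r0 (sF h)).
    by rewrite P0 (linear0l inner).
  have := E 1%N; rewrite -[X in _ = _ + X]/(Defs.sintegral F (horner (Qpoly R
    1))) -Q1.
  by rewrite !expr1 mulr1n exp1n mulr1n addr0 => ->;
    rewrite -CE [1 + B]addrC -!addrA [C + _]addrC subrK subrr addr0.
move=> D bD; have bD1 : borel_halfline (D `\` [set 1 : R]).
  by case: bD => mD sD; split; [exact: measurableD|exact: subset_trans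
    (@subDsetl _ _ _) sD].
rewrite ME// M'E// /at1 memNset ?addr0; last by move=> [_ /(_ erefl)].
have b1 := borel_set1; apply: qf_inj => [||h]; [exact: smeas_ge0|exact: smeas_ge0|].
have F10 := (smeas_eq0 F b1).1 F1 h.
suff : qmeas F h D = qmeas F h (D `\` [set 1]) by rewrite !qmeasE// => -[].
rewrite -(measureU0 bD.1 b1.1 F10) -(measureU0 bD1.1 b1.1 F10).
congr (qmeas F h _); apply/seteqP; split=> x [Dx|->]; [|by right|left;
  exact: Dx.1|by right].
by have [->|x1] := pselect (x = 1); [right|left].
Qed.

End Representations.

Theorem theorem1p3p1 (R : realType) (H : hilbertType R) (T : bop H) :
  [/\ (cpd T <-> exists (B C : bop H) (F : semispectral H), cpd_triplet T B C F),
      (cpd T <-> exists M : semispectral H, cpd_measure T M),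
      (forall (B C B' C' : bop H) (F F' : semispectral H),
         cpd_triplet T B C F -> cpd_triplet T B' C' F' ->
         [/\ B = B', C = C' & eq_semispectral F F']),
      (forall M M' : semispectral H,
         cpd_measure T M -> cpd_measure T M' -> eq_semispectral M M') &
      (forall (B C : bop H) (F M : semispectral H),
         cpd_triplet T B C F -> cpd_measure T M ->
         [/\ B = adj T * T - 1 - (2^-1 : R[i]) *: M [set 1],
             C = (2^-1 : R[i]) *: M [set 1] &
             forall D : set R, borel_halfline D -> F D = M (D `\` [set 1])])].
Proof.
split.
- split=> [/measure_of_cpd[M]|[B [C [F tF]]]].
    by move/triplet_of_measure => [F tF _]; do 3 eexists; exact: tF.
  by have [M cM _] := measure_of_triplet tF; exact: cpd_of_measure cM.
- by split=> [/measure_of_cpd|[M]]; last exact: cpd_of_measure.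
(* The measure built from the first triplet determines both triplets. *)
- move=> B C B' C' F F' tF tF'; have [M cM _] := measure_of_triplet tF.
  have [-> -> FM] := cpd_formulas tF cM; have [-> -> FM'] := cpd_formulas tF' cM.
  by split=> // D bD; rewrite FM// FM'.
- exact: cpd_measure_unique.
- exact: cpd_formulas.
Qed.
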